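(* Let $S$ be a concordant semigroup with consistent categories $\mathbb{L}(S)$ and $\mathbb{R}(S)$. Define functors $\Gamma_S\colon\mathbb{R}(S)\to\mathbb{L}(S)^*$ and $\Delta_S\colon\mathbb{L}(S)\to\mathbb{R}(S)^*$ by $$\Gamma_S(eS)=H(\rho^e;-),\qquad \Gamma_S(\lambda(e,u,f))=\eta_{\rho^e}\,\mathbb{L}(S)(\rho(f,u,e),-)\,\eta_{\rho^f}^{-1},$$ $$\Delta_S(Se)=H(\lambda^e;-),\qquad \Delta_S(\rho(e,u,f))=\eta_{\lambda^e}\,\mathbb{R}(S)(\lambda(f,u,e),-)\,\eta_{\lambda^f}^{-1}.$$ Then $\Omega S=(\mathbb{L}(S),\mathbb{R}(S);\Gamma_S,\Delta_S)$ is a cross-connection between $\mathbb{L}(S)$ and $\mathbb{R}(S)$.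
   Context: Functions, morphisms and natural transformations are composed from left to right. **Concordant semigroups.** For a semigroup $S$, $a\mathrel{\mathscr{L}^*}b$ ($a\mathrel{\mathscr{R}^*}b$) means that $a,b$ are $\mathscr{L}$-related ($\mathscr{R}$-related) in some oversemigroup of $S$; equivalently, for all $x,y\in S^1$: $ax=ay\iff bx=by$ (resp. $xa=ya\iff xb=yb$). $L^*_a,R^*_a$ are the classes of $a$. $S$ is abundant if each $\mathscr{L}^*$-class and each $\mathscr{R}^*$-class contains an idempotent. $E(S)$ is the set of idempotents; for $e\in E(S)$, $\omega(e)=\{g\in E(S): ge=eg=g\}$ and $\langle e\rangle$ is the subsemigroup generated by $\omega(e)$. $S$ is idempotent-connected if for each $a\in S$ and for some idempotents $a^\dagger\in R^*_a$, $a^*\in L^*_a$ there is a bijection $\alpha\colon\langle a^\dagger\rangle\to\langle a^*\rangle$ with $xa=a(x\alpha)$ for all $x\in\langle a^\dagger\rangle$. A concordant semigroup is an idempotent-connected abundant semigroup whose idempotents generate a regular subsemigroup. **$\mathbb{L}(S)$ and $\mathbb{R}(S)$.** $\mathbb{L}(S)$ has objects $Se$ ($e\in E(S)$) and morphisms $\rho(e,u,f)\colon Se\to Sf$, $x\mapsto xu$, with $u\in eSf$; its inclusions are $\rho(e,e,f)$ for $Se\subseteq Sf$. $\mathbb{R}(S)$ has objects $eS$ and morphisms $\lambda(e,u,f)\colon eS\to fS$, $x\mapsto ux$, with $u\in fSe$; its inclusions are $\lambda(e,e,f)$ for $eS\subseteq fS$. For $a\in S$ the principal cones are $\rho^a(Se)=\rho(e,ea,f)$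 with $f\in E(S)\cap L^*_a$ (a cone in $\mathbb{L}(S)$ with apex $Sf$) and $\lambda^a(eS)=\lambda(e,ae,f)$ with $f\in E(S)\cap R^*_a$ (a cone in $\mathbb{R}(S)$ with apex $fS$). **Categories with subobjects.** A pair $(\mathcal{C},\mathcal{P})$, with $\mathcal{C}$ a small category and $\mathcal{P}$ a subcategory, such that: $\mathcal{P}$ is a strict preorder (at most one morphism between any two objects; identities are the only isomorphisms) with $v\mathcal{P}=v\mathcal{C}$ ($v$ denotes the object set); every $f\in\mathcal{P}$ is a monomorphism in $\mathcal{C}$; if $f,g\in\mathcal{P}$ and $f=hg$ with $h\in\mathcal{C}$, then $h\in\mathcal{P}$. Morphisms of $\mathcal{P}$ are inclusions; write $c'\subseteq c$ ($c'$ is a subobject of $c$) and $j_{c'}^{c}$ for the inclusion $c'\to c$. An inclusion $j_{c'}^c$ splits if there is $q\colon c\to c'$ with $j_{c'}^cq=1_{c'}$; such $q$ is a retraction. A bimorphism is a morphism that is both left and right cancellable. A consistent (resp. normal) factorisation of $f$ is $f=quj$ with $q$ a retraction, $u$ a bimorphism (resp. isomorphism), $j$ an inclusion; then $f^\circ=qu$ (which is unique) is the epimorphic component of $f$, and its codomain is $\mathrm{im} f$. For $c\in v\mathcal{C}$, the ideal $(c)$ is the full subcategory of $\mathcal{C}$ on the subobjects of $c$; $\sigma(c)$ is the preorder of subobjects of $c$ with inclusions as morphisms; $cor\,\mathcal{C}$ is the subcategory of $\mathcal{C}$ generated by inclusions and retractions, and $\langle c\rangle$ is the full subcategory of $cor\,\mathcal{C}$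 generated by the inclusions and retractions among the subobjects of $c$. A bimorphism $u\colon c\to d$ is consistent if the functor $T^u\colon\sigma(c)\to\sigma(d)$ defined by $T^u(c')=\mathrm{im}(j_{c'}^cu)$ and $T^u(j_{c'}^{c''})=j_{T^u(c')}^{T^u(c'')}$ for each $c'\subseteq c''\subseteq c$ can be extended uniquely to an isomorphism $T\colon\langle c\rangle\to\langle d\rangle$ such that the map given by $c'\mapsto T(c')$ is a natural isomorphism between the functors $J(\langle c\rangle,\mathcal{C})$ and $T\colon\langle c\rangle\to\mathcal{C}$, where $J(\langle c\rangle,\mathcal{C})$ is the inclusion functor of $\langle c\rangle$ in $\mathcal{C}$. A consistent cone $\gamma$ with apex $c_\gamma$ is a map $\gamma\colon v\mathcal{C}\to\mathcal{C}$, $\gamma(a)\in\mathcal{C}(a,c_\gamma)$, with $j_a^b\gamma(b)=\gamma(a)$ whenever $a\subseteq b$ and with at least one $\gamma(c)$ a bimorphism. **Consistent category.** A category $\mathcal{C}$ with subobjects such that: every inclusion splits; every morphism has a consistent factorisation; every bimorphism is consistent; every morphism of the form $jq$ with $j$ an inclusion and $q$ a retraction has a normal factorisation; for each $c\in v\mathcal{C}$ there is a consistent cone $\epsilon$ with $\epsilon(c)=1_c$. **Dual.** An idempotent cone is a consistent cone $\epsilon$ with $\epsilon(c_\epsilon)=1_{c_\epsilon}$. For a consistent cone $\gamma$ and an epimorphism $f\colon c_\gamma\to d$, $\gamma\ast f$ is the cone $c\mapsto\gamma(c)f$ with apex $d$. For an idempotent cone $\epsilon$, $H(\epsilon;-)\colon\mathcal{C}\to\mathbf{Set}$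 is given by $H(\epsilon;c)=\{\epsilon\ast f^\circ: f\in\mathcal{C}(c_\epsilon,c)\}$ and $H(\epsilon;g)\colon\epsilon\ast f^\circ\mapsto\epsilon\ast(fg)^\circ$; there is a natural isomorphism $\eta_\epsilon\colon H(\epsilon;-)\to\mathcal{C}(c_\epsilon,-)$, $\epsilon\ast f^\circ\mapsto f$. The consistent dual $\mathcal{C}^*$ is the full subcategory of the functor category $[\mathcal{C},\mathbf{Set}]$ with objects all $H(\epsilon;-)$, $\epsilon$ an idempotent cone in $\mathcal{C}$; its inclusions are the inclusions of subfunctors ($H(\epsilon;-)\subseteq H(\epsilon';-)$ if $H(\epsilon;c)\subseteq H(\epsilon';c)$ for all $c$ and these set inclusions are natural in $c$). $MH(\epsilon;-)=\{c\in v\mathcal{C}:\epsilon(c)\text{ is an isomorphism}\}$. **Cross-connection.** A functor $F\colon\mathcal{C}\to\mathcal{D}$ between consistent categories is a local isomorphism if it is inclusion preserving, fully faithful, and for each $c\in v\mathcal{C}$ restricts to an isomorphism of the ideal $(c)$ onto $(F(c))$. A cross-connection between consistent categories $\mathcal{C}$ and $\mathcal{D}$ is a quadruplet $(\mathcal{C},\mathcal{D};\Gamma,\Delta)$ where $\Gamma\colon\mathcal{D}\to\mathcal{C}^*$ and $\Delta\colon\mathcal{C}\to\mathcal{D}^*$ are local isomorphisms such that for $c\in v\mathcal{C}$, $d\in v\mathcal{D}$: $c\in M\Gamma(d)\iff d\in M\Delta(c)$.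
   Formalization: In ''consistent bimorphism'', the natural isomorphism from J(⟨c⟩,C) to T is replaced by a natural transformation with components (j u)°; requiring isomorphisms fails for S={e,f,u,0} with ee=e, ff=f, eu=u=uf, other products 0, where Se and Sf are not isomorphic. *)

(* Defs.v *)
From HB Require Import structures.
From mathcomp Require Import all_boot all_classical.

Set Implicit Arguments.
Unset Strict Implicit.
Unset Printing Implicit Defensive.

Local Open Scope classical_set_scope.
Local Open Scope group_scope.

(* Morphisms, functors and natural transformations are composed from left to
   right.  Objects and morphisms are compared with Leibniz equality. *)

Reserved Notation "f ;; g" (at level 50, left associativity).

Lemma sval_inj (T : Type) (P : T -> Prop) : injective (@sval T P).
Proof. by case=> x Px [y Py] /= xy; exact: eq_exist. Qed.

(** * Categories, functors, natural transformations *)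

Record category := Category {
  obj :> Type;
  hom : obj -> obj -> Type;
  idm : forall a, hom a a;
  comp : forall a b c, hom a b -> hom b c -> hom a c;
  comp1m : forall a b (f : hom a b), comp (idm a) f = f;
  compm1 : forall a b (f : hom a b), comp f (idm b) = f;
  compA : forall a b c d (f : hom a b) (g : hom b c) (h : hom c d),
    comp f (comp g h) = comp (comp f g) h }.

Arguments idm {_} a.
Notation "f ;; g" := (comp f g).

(* Equality of [arrow f] and [arrow g] is equality of morphisms whose domains
   and codomains are not known to agree definitionally. *)
Definition arrow (C : category) (a b : C) (f : hom a b) :
  {p : C * C & hom p.1 p.2} := existT _ (a, b) f.

Lemma arrow_inj (C : category) (a b : C) (f g : hom a b) :
  arrow f = arrow g -> f = g.
Proof.
move=> h; have := projT2_eq h.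
by rewrite (Prop_irrelevance (projT1_eq h) erefl).
Qed.

Lemma arrow_cod (C : category) (a b c : C) (f : hom a b) (g : hom a c) :
  arrow f = arrow g -> b = c.
Proof. by move=> h; have [] := projT1_eq h. Qed.

Variant is_identity (C : category) : forall a b : C, hom a b -> Prop :=
  IsIdentity a : is_identity (idm a).

Section Morphisms.
Variables (C : category) (a b : C).
Implicit Type f : hom a b.

Definition mono f := forall c (h k : hom c a), h ;; f = k ;; f -> h = k.
Definition epi f := forall c (h k : hom b c), f ;; h = f ;; k -> h = k.
Definition bimorphism f := mono f /\ epi f.
Definition isom f := exists g : hom b a, f ;; g = idm a /\ g ;; f = idm b.

End Morphisms.

Record functor (C D : category) := Functor {
  fobj :> C -> D;
  fmap : forall a b, hom a b -> hom (fobj a) (fobj b);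
  fmap1 : forall a, fmap (idm a) = idm (fobj a);
  fmapM : forall a b c (f : hom a b) (g : hom b c),
    fmap (f ;; g) = fmap f ;; fmap g }.

Arguments fmap {C D} _ {a b} _.

Lemma functor_comp1 (C D E : category) (F : functor C D) (G : functor D E)
  (a : C) : fmap G (fmap F (idm a)) = idm (G (F a)).
Proof. by rewrite !fmap1. Qed.

Lemma functor_compM (C D E : category) (F : functor C D) (G : functor D E)
    (a b c : C) (f : hom a b) (g : hom b c) :
  fmap G (fmap F (f ;; g)) = fmap G (fmap F f) ;; fmap G (fmap F g).
Proof. by rewrite !fmapM. Qed.

Definition functor_comp (C D E : category) (F : functor C D)
    (G : functor D E) : functor C E :=
  @Functor C E (fun a => G (F a)) (fun a b f => fmap G (fmap F f))
    (functor_comp1 F G) (@functor_compM C D E F G).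

Definition fully_faithful (C D : category) (F : functor C D) :=
  forall a b : C, bijective (fun f : hom a b => fmap F f).

Definition cat_iso (C D : category) (F : functor C D) :=
  bijective (fobj F) /\ fully_faithful F.

Record nat_trans (C D : category) (F G : functor C D) := NatTrans {
  ntc :> forall a, hom (F a) (G a);
  nt_nat : forall a b (f : hom a b), fmap F f ;; ntc b = ntc a ;; fmap G f }.

Lemma nat_trans_eq (C D : category) (F G : functor C D) (s t : nat_trans F G) :
  (forall a, s a = t a) -> s = t.
Proof.
case: s t => [s sP] [t tP] /= st.
have {st} e : s = t by apply: functional_extensionality_dep.
by subst t; congr NatTrans; exact: Prop_irrelevance.
Qed.

Section FunctorCategory.
Variables C D : category.

Program Definition nt_id (F : functor C D) : nat_trans F F :=
  @NatTrans _ _ F F (fun a => idm (F a)) _.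
Next Obligation. by move=> F a b f; rewrite comp1m compm1. Qed.

Program Definition nt_comp (F G H : functor C D) (s : nat_trans F G)
    (t : nat_trans G H) : nat_trans F H :=
  @NatTrans _ _ F H (fun a => s a ;; t a) _.
Next Obligation.
by move=> F G H s t a b f; rewrite compA nt_nat -compA nt_nat compA.
Qed.

Program Definition functor_cat : category :=
  @Category (functor C D) (@nat_trans C D) nt_id nt_comp _ _ _.
Next Obligation. by move=> F G s; apply: nat_trans_eq => a; exact: comp1m. Qed.
Next Obligation. by move=> F G s; apply: nat_trans_eq => a; exact: compm1. Qed.
Next Obligation.
by move=> F G H K s t u; apply: nat_trans_eq => a; exact: compA.
Qed.

End FunctorCategory.

Program Definition full_subcat (C : category) (P : C -> Prop) : category :=
  @Category {a : C | P a} (fun a b => hom (sval a) (sval b))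
    (fun a => idm (sval a)) (fun a b c f g => f ;; g) _ _ _.
Next Obligation. by move=> *; exact: comp1m. Qed.
Next Obligation. by move=> *; exact: compm1. Qed.
Next Obligation. by move=> *; exact: compA. Qed.

Section Subcategory.
Variables (C : category) (P : C -> Prop).
Variable Q : forall a b : C, hom a b -> Prop.
Hypothesis Q1 : forall a, P a -> Q (idm a).
Hypothesis QM : forall a b c (f : hom a b) (g : hom b c),
  P a -> P b -> P c -> Q f -> Q g -> Q (f ;; g).

Program Definition subcat : category :=
  @Category {a : C | P a}
    (fun a b => {f : hom (sval a) (sval b) | Q f})
    (fun a => exist _ (idm (sval a)) (Q1 (svalP a)))
    (fun a b c f g => exist _ (sval f ;; sval g)
       (QM (svalP a) (svalP b) (svalP c) (svalP f) (svalP g))) _ _ _.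
Next Obligation. by move=> a b [f Qf]; apply: eq_exist; exact: comp1m. Qed.
Next Obligation. by move=> a b [f Qf]; apply: eq_exist; exact: compm1. Qed.
Next Obligation.
by move=> a b c d [f Qf] [g Qg] [h Qh]; apply: eq_exist; exact: compA.
Qed.

Program Definition subcat_incl : functor subcat C :=
  @Functor subcat C (fun a => sval a) (fun a b f => sval f) _ _.
Next Obligation. by []. Qed.
Next Obligation. by []. Qed.

End Subcategory.

(* The full subcategory of Set on the subsets of [U]. *)
Program Definition Sets (U : Type) : category :=
  @Category (set U) (fun A B => {x | A x} -> {x | B x})
    (fun A => id) (fun A B C f g => g \o f) _ _ _.
Next Obligation. by []. Qed.
Next Obligation. by []. Qed.
Next Obligation. by []. Qed.

(** * Categories with subobjects *)

Record catsub := CatSub {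
  catsub_cat :> category;
  incl : forall a b : catsub_cat, hom a b -> Prop;
  incl1 : forall a : catsub_cat, incl (idm a);
  inclM : forall (a b c : catsub_cat) (f : hom a b) (g : hom b c),
    incl f -> incl g -> incl (f ;; g);
  incl_thin : forall (a b : catsub_cat) (f g : hom a b),
    incl f -> incl g -> f = g;
  incl_strict : forall (a b : catsub_cat) (f : hom a b) (g : hom b a),
    incl f -> incl g -> f ;; g = idm a -> g ;; f = idm b -> is_identity f;
  incl_mono : forall (a b : catsub_cat) (f : hom a b), incl f -> mono f;
  incl_factor : forall (a b c : catsub_cat) (h : hom a b) (g : hom b c),
    incl (h ;; g) -> incl g -> incl h }.

Section Subobjects.
Variable C : catsub.

Definition subobj (a b : C) := exists j : hom a b, incl j.

Definition retraction (a b : C) (q : hom a b) :=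
  exists2 j : hom b a, incl j & j ;; q = idm b.

Definition splits (a b : C) (j : hom a b) :=
  exists q : hom b a, j ;; q = idm a.

(* [p] is the epimorphic component of a consistent factorisation of [f]; the
   codomain of [p] is then the image of [f]. *)
Definition epi_component (a b d : C) (f : hom a b) (p : hom a d) :=
  exists (c : C) (q : hom a c) (u : hom c d) (j : hom d b),
    [/\ retraction q, bimorphism u & incl j] /\ p = q ;; u /\ f = q ;; u ;; j.

Definition has_consistent_factorisation (a b : C) (f : hom a b) :=
  exists (d : C) (p : hom a d), epi_component f p.

Definition has_normal_factorisation (a b : C) (f : hom a b) :=
  exists (c d : C) (q : hom a c) (u : hom c d) (j : hom d b),
    [/\ retraction q, isom u & incl j] /\ f = q ;; u ;; j.

Definition ideal (c : C) : category := full_subcat (fun a : C => subobj a c).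

(* The morphisms of <c>: composites of inclusions and retractions all of whose
   intermediate objects are subobjects of [c]. *)
Inductive core_mor (c : C) : forall a b : C, hom a b -> Prop :=
| core_incl (a b : C) (j : hom a b) :
    subobj a c -> subobj b c -> incl j -> core_mor c j
| core_retr (a b : C) (q : hom a b) :
    subobj a c -> subobj b c -> retraction q -> core_mor c q
| core_comp (a b d : C) (f : hom a b) (g : hom b d) :
    core_mor c f -> core_mor c g -> core_mor c (f ;; g).

Lemma core_mor1 (c a : C) : subobj a c -> core_mor c (idm a).
Proof. by move=> ac; apply: core_incl => //; exact: incl1. Qed.

Lemma core_morM (c a b d : C) (f : hom a b) (g : hom b d) :
  subobj a c -> subobj b c -> subobj d c ->
  core_mor c f -> core_mor c g -> core_mor c (f ;; g).
Proof. by move=> _ _ _; exact: core_comp. Qed.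

Definition core (c : C) : category := subcat (@core_mor1 c) (@core_morM c).

Definition core_functor (c : C) : functor (core c) C :=
  subcat_incl (@core_mor1 c) (@core_morM c).

(* [T] extends T^u, and the morphisms (j_{c'}^c u)° : c' -> im (j_{c'}^c u) =
   T(c') are the components of a natural transformation from the inclusion
   functor of <c> to T.  They are bimorphisms, and that at [c] is [u] itself, so
   they are isomorphisms only if [u] is one. *)
Definition consistent_extension (c d : C) (u : hom c d)
    (T : functor (core c) (core d)) :=
  [/\ cat_iso T,
      forall (x : core c) (j : hom (sval x) c), incl j ->
        exists p : hom (sval x) (sval (T x)), epi_component (j ;; u) p,
      forall (x y : core c) (i : hom x y),
        incl (sval i) -> incl (sval (fmap T i))
    & exists t : nat_trans (core_functor c) (functor_comp T (core_functor d)),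
        forall (x : core c) (j : hom (sval x) c), incl j ->
          epi_component (j ;; u) (t x)].

Definition consistent_bimorphism (c d : C) (u : hom c d) :=
  bimorphism u /\ exists! T, consistent_extension u T.

Record cone := Cone {
  apex : C;
  leg : forall a : C, hom a apex;
  leg_incl : forall (a b : C) (j : hom a b), incl j -> j ;; leg b = leg a }.

Definition consistent_cone (g : cone) := exists c, bimorphism (leg g c).

Record consistent_category : Prop := ConsistentCategory {
  cc_splits : forall (a b : C) (j : hom a b), incl j -> splits j;
  cc_factor : forall (a b : C) (f : hom a b), has_consistent_factorisation f;
  cc_bim : forall (a b : C) (u : hom a b),
    bimorphism u -> consistent_bimorphism u;
  cc_normal : forall (a b c : C) (j : hom a b) (q : hom b c),
    incl j -> retraction q -> has_normal_factorisation (j ;; q);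
  cc_cone : forall c : C, exists e : cone,
    consistent_cone e /\ arrow (leg e c) = arrow (idm c) }.

Record idem_cone := IdemCone {
  ic_cone :> cone;
  ic_consistent : consistent_cone ic_cone;
  ic_id : leg ic_cone (apex ic_cone) = idm (apex ic_cone) }.

Program Definition cone_star (g : cone) (d : C) (f : hom (apex g) d) : cone :=
  @Cone d (fun a => leg g a ;; f) _.
Next Obligation.
by move=> g d f a b j ij /=; rewrite compA (leg_incl g ij).
Qed.

Lemma subobj_antisym (a b : C) (i : hom a b) (j : hom b a) :
  incl i -> incl j -> is_identity i.
Proof.
move=> ii ij; apply: (incl_strict ii ij);
  by apply: incl_thin; [exact: inclM | exact: incl1].
Qed.

Lemma retraction_epi (a b : C) (q : hom a b) : retraction q -> epi q.
Proof.
case=> j _ jq c h k e.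
by rewrite -[h]comp1m -[k]comp1m -jq -!compA e.
Qed.

Lemma epi_component_epi (a b d : C) (f : hom a b) (p : hom a d) :
  epi_component f p -> epi p.
Proof.
case=> c [q] [u] [j] [[qR [_ uE] _] [-> _]] e h k.
by rewrite -!compA => /(retraction_epi qR)/uE.
Qed.

Lemma epi_componentE (a b d : C) (f : hom a b) (p : hom a d) :
  epi_component f p -> exists2 j : hom d b, incl j & f = p ;; j.
Proof.
by case=> c [q] [u] [j] [[_ _ ij] [-> ->]]; exists j.
Qed.

Lemma arrow_incl (a b b' d : C) (p : hom a b) (p' : hom a b') (j : hom b d)
    (j' : hom b' d) :
  arrow p = arrow p' -> incl j -> incl j' -> p ;; j = p' ;; j'.
Proof.
move=> pp' ij ij'; have e := arrow_cod pp'; subst b'.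
by rewrite (arrow_inj pp') (incl_thin ij ij').
Qed.

Lemma epi_component_uniq (a b d d' : C) (f : hom a b) (p : hom a d)
    (p' : hom a d') :
  (forall (c e : C) (j : hom c e), incl j -> splits j) ->
  epi_component f p -> epi_component f p' -> arrow p = arrow p'.
Proof.
move=> sp pP p'P; have [j ij fE] := epi_componentE pP.
have [j' ij' fE'] := epi_componentE p'P.
have pe := epi_component_epi pP; have p'e := epi_component_epi p'P.
have [r jr] := sp _ _ _ ij; have [r' jr'] := sp _ _ _ ij'.
have pp' : p ;; j = p' ;; j' by rewrite -fE.
have e1 : (j ;; r') ;; j' = j.
  by apply: pe; rewrite !compA pp' -(compA p') jr' compm1.
have e2 : (j' ;; r) ;; j = j'.
  by apply: p'e; rewrite !compA -pp' -(compA p) jr compm1.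
have i1 : incl (j ;; r') by apply: (incl_factor (g := j')); rewrite ?e1.
have i2 : incl (j' ;; r) by apply: (incl_factor (g := j)); rewrite ?e2.
have : d = d' by case: (subobj_antisym i1 i2).
move=> e; subst d'; congr arrow; apply: (incl_mono ij).
by rewrite pp' (incl_thin ij' ij).
Qed.

End Subobjects.

(** * The consistent dual *)

Section Dual.
Variables (C : catsub) (HC : consistent_category C).

(* The epimorphic component f° : a -> im f; by [epi_component_uniq] it does not
   depend on the factorisation that is chosen. *)
Definition im (a b : C) (f : hom a b) : C := sval (cid (cc_factor HC f)).

Definition epart (a b : C) (f : hom a b) : hom a (im f) :=
  sval (cid (svalP (cid (cc_factor HC f)))).

Lemma epartP (a b : C) (f : hom a b) : epi_component f (epart f).
Proof. exact: (svalP (cid (svalP (cid (cc_factor HC f))))). Qed.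

Lemma cone_star_inj (e : idem_cone C) (c : C) (f g : hom (apex e) c) :
  cone_star (epart f) = cone_star (epart g) -> f = g.
Proof.
move=> /(congr1 (fun k => arrow (leg k (apex e)))) /=.
rewrite ic_id !comp1m => fg.
have [j ij ->] := epi_componentE (epartP f).
have [j' ij' ->] := epi_componentE (epartP g).
exact: arrow_incl.
Qed.

(* H(e;c) is a set of cones, so H(e;-) is a functor into the full subcategory
   of Set on the subsets of [cone C]. *)
Definition Hset (e : idem_cone C) (c : C) : set (cone C) :=
  [set g | exists f : hom (apex e) c, g = cone_star (epart f)].

Definition eta (e : idem_cone C) (c : C) (g : {g | Hset e c g}) :
  hom (apex e) c := sval (cid (svalP g)).

Definition eta_inv (e : idem_cone C) (c : C) (f : hom (apex e) c) :
  {g | Hset e c g} :=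
  exist _ (cone_star (epart f)) (ex_intro _ f erefl).

Lemma etaP (e : idem_cone C) (c : C) (g : {g | Hset e c g}) :
  sval g = cone_star (epart (eta g)).
Proof. exact: (svalP (cid (svalP g))). Qed.

Lemma etaK (e : idem_cone C) (c : C) : cancel (@eta e c) (@eta_inv e c).
Proof. by move=> g; apply: sval_inj; rewrite [RHS]etaP. Qed.

Lemma eta_invK (e : idem_cone C) (c : C) : cancel (@eta_inv e c) (@eta e c).
Proof. by move=> f; apply: (@cone_star_inj e); rewrite -etaP. Qed.

Program Definition Hfunctor (e : idem_cone C) : functor C (Sets (cone C)) :=
  @Functor C (Sets (cone C)) (Hset e)
    (fun c d g x => eta_inv (eta x ;; g)) _ _.
Next Obligation.
by move=> e c /=; apply: funext => x; rewrite compm1 etaK.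
Qed.
Next Obligation.
by move=> e a b c f g /=; apply: funext => x /=; rewrite eta_invK compA.
Qed.

(* The composite eta_e C(g,-) eta_e'^-1. *)
Program Definition Htrans (e e' : idem_cone C) (g : hom (apex e') (apex e)) :
    nat_trans (Hfunctor e) (Hfunctor e') :=
  @NatTrans _ _ (Hfunctor e) (Hfunctor e')
    (fun c x => eta_inv (g ;; eta x)) _.
Next Obligation.
by move=> e e' g a b f /=; apply: funext => x /=; rewrite !eta_invK compA.
Qed.

Definition dual_cat : category :=
  @full_subcat (functor_cat C (Sets (cone C)))
    (fun F => exists e : idem_cone C, F = Hfunctor e).

Definition dual_incl (F G : dual_cat) (t : hom F G) :=
  forall (c : C) (x : {g | sval F c g}),
    sval ((t : nat_trans (sval F) (sval G)) c x) = sval x.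

Lemma dual_incl1 (F : dual_cat) : dual_incl (idm F).
Proof. by []. Qed.

Lemma dual_inclM (F G H : dual_cat) (s : hom F G) (t : hom G H) :
  dual_incl s -> dual_incl t -> dual_incl (s ;; t).
Proof. by move=> si ti c x; rewrite /= ti si. Qed.

Lemma dual_incl_thin (F G : dual_cat) (s t : hom F G) :
  dual_incl s -> dual_incl t -> s = t.
Proof.
move=> si ti; apply: nat_trans_eq => c; apply: funext => x.
by apply: sval_inj; rewrite si ti.
Qed.

Lemma dual_incl_antisym (F G : dual_cat) (s : hom F G) (t : hom G F) :
  dual_incl s -> dual_incl t -> F = G.
Proof.
case: F s t => F FH; case: G => G GH /= s t si ti; apply: eq_exist.
rewrite /dual_incl /= in si ti; clear FH GH.
have FG : fobj F = fobj G.
  apply: funext => c; apply/seteqP; split=> x xF.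
    by rewrite -[x](si c (exist _ x xF)); exact: svalP.
  by rewrite -[x](ti c (exist _ x xF)); exact: svalP.
case: s si {ti t} => s sN /= si; case: F G FG s sN si.
move=> F Fm F1 FM [G Gm G1 GM] /= FG; subst G => s sN si.
have sE c x : s c x = x by apply: sval_inj; exact: si.
have FmG : Fm = Gm.
  apply: functional_extensionality_dep => a.
  apply: functional_extensionality_dep => b.
  apply: funext => f; apply: funext => x.
  by have /(congr1 (fun h => h x)) /= := sN a b f; rewrite !sE.
by subst Gm; congr Functor; exact: Prop_irrelevance.
Qed.

Program Definition dual : catsub :=
  @CatSub dual_cat dual_incl dual_incl1 dual_inclM dual_incl_thin _ _ _.
Next Obligation.
move=> F G s t si ti _ _; have FG := dual_incl_antisym si ti; subst G.
by rewrite (dual_incl_thin si (@dual_incl1 F)); exact: IsIdentity.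
Qed.
Next Obligation.
move=> F G s si K h k hk; apply: nat_trans_eq => c; apply: funext => x.
have /(congr1 sval) /= := congr1 (fun t : nat_trans (sval K) (sval G) =>
  (t c : {g | sval K c g} -> {g | sval G c g}) x) hk.
by rewrite !si => /sval_inj.
Qed.
Next Obligation.
by move=> F G K h g hgi gi c x; rewrite -[RHS](hgi c x) /= gi.
Qed.

Definition dualH (e : idem_cone C) : dual :=
  exist _ (Hfunctor e) (ex_intro _ e erefl).

(* MX for X = H(e;-); it does not depend on the idempotent cone e that
   represents X. *)
Definition Mset (X : dual) : set C :=
  [set c | exists e : idem_cone C, X = dualH e /\ isom (leg e c)].

End Dual.

(** * Cross-connections *)

Section LocalIsomorphism.
Variables (C D : catsub) (F : functor C D).

Definition incl_preserving :=
  forall (a b : C) (j : hom a b), incl j -> incl (fmap F j).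

Lemma ideal_functor_subobj (FI : incl_preserving) (a c : C) :
  subobj a c -> subobj (F a) (F c).
Proof. by case=> j ij; exists (fmap F j); exact: FI. Qed.

Program Definition ideal_functor (FI : incl_preserving) (c : C) :
    functor (ideal c) (ideal (F c)) :=
  @Functor (ideal c) (ideal (F c))
    (fun a => exist _ (F (sval a)) (ideal_functor_subobj FI (svalP a)))
    (fun a b f => fmap F f) _ _.
Next Obligation. by move=> FI c a; exact: fmap1. Qed.
Next Obligation. by move=> FI c a b d f g; exact: fmapM. Qed.

Definition local_iso :=
  exists FI : incl_preserving,
    fully_faithful F /\ forall c : C, cat_iso (ideal_functor FI c).

End LocalIsomorphism.

Record cross_connection (C D : catsub) (HC : consistent_category C)
    (HD : consistent_category D) (Gam : functor D (dual HC))
    (Del : functor C (dual HD)) : Prop := CrossConnection {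
  cross_Gam : local_iso Gam;
  cross_Del : local_iso Del;
  cross_M : forall (c : C) (d : D), Mset (Gam d) c <-> Mset (Del c) d }.

(** * Concordant semigroups *)

Section Semigroups.
Variable S : semigroupType.
Implicit Types a b e x y : S.

(* Multiplication by elements of S^1, [None] being the adjoined identity. *)
Definition mul1l (x : option S) a := if x is Some x then x * a else a.
Definition mul1r a (x : option S) := if x is Some x then a * x else a.

Definition Lstar a b :=
  forall x y : option S, mul1r a x = mul1r a y <-> mul1r b x = mul1r b y.
Definition Rstar a b :=
  forall x y : option S, mul1l x a = mul1l y a <-> mul1l x b = mul1l y b.

Definition idempotents : set S := [set e | e * e = e].

Definition abundant :=
  (forall a, exists2 e, idempotents e & Lstar a e) /\
  (forall a, exists2 e, idempotents e & Rstar a e).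

Definition subsemigroup (A : set S) := forall x y, A x -> A y -> A (x * y).

Definition generated (A : set S) : set S := smallest subsemigroup A.

Definition omega e : set S :=
  [set g | idempotents g /\ (g * e = g /\ e * g = g)].

Definition idempotent_connected :=
  forall a, exists r l, [/\ idempotents r, Rstar a r, idempotents l & Lstar a l]
    /\ exists alpha : {x | generated (omega r) x} -> {x | generated (omega l) x},
         bijective alpha /\ forall z, sval z * a = a * sval (alpha z).

Definition regular_subset (A : set S) :=
  forall x, A x -> exists2 y, A y & x * y * x = x.

Definition concordant :=
  [/\ abundant, idempotent_connected & regular_subset (generated idempotents)].

End Semigroups.

Definition opp_semigroup (S : Type) : Type := S.
Notation "S ^opp" := (opp_semigroup S) (at level 2, format "S ^opp").

Section Opposite.
Variable S : semigroupType.
HB.instance Definition _ := Choice.on S^opp.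

Lemma opp_mulgA : associative (fun x y : S^opp => (y : S) * (x : S)).
Proof. by move=> x y z; rewrite mulgA. Qed.

HB.instance Definition _ := isSemigroup.Build S^opp opp_mulgA.
End Opposite.

(** * The categories L(S) and R(S) *)

Definition idem (S : semigroupType) := {e : S | e * e = e}.

Section L.
Variable S : semigroupType.
Implicit Types e f g h : idem S.

Lemma idemE e : sval e * sval e = sval e.
Proof. exact: svalP e. Qed.

(* u \in e S f *)
Definition corner e (u : S) f := exists s : S, u = sval e * s * sval f.

Lemma cornerP e u f : corner e u f <-> sval e * u = u /\ u * sval f = u.
Proof.
split=> [[s ->]|[eu uf]]; last by exists u; rewrite eu uf.
by rewrite !mulgA idemE -!mulgA idemE.
Qed.

Lemma corner_idem e : corner e (sval e) e.
Proof. by exists (sval e); rewrite !idemE. Qed.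

(* The set S e. *)
Definition lideal e : set S := [set x | exists y : S, x = y * sval e].

Lemma lidealP e x : lideal e x <-> x * sval e = x.
Proof.
split=> [[y ->]|xe]; last by exists x.
by rewrite -mulgA idemE.
Qed.

Definition is_lideal (A : set S) := exists e, A = lideal e.

(* [m] is a map rho(e,u,f) : S e -> S f, x |-> x u. *)
Definition is_rho (A B : Sets S) (m : hom A B) :=
  exists e f (u : S), [/\ A = lideal e, B = lideal f & corner e u f]
    /\ forall x : {x | A x}, sval ((m : {x | A x} -> {x | B x}) x) = sval x * u.

Lemma is_rho1 (A : Sets S) : is_lideal A -> is_rho (idm A).
Proof.
move=> [e ->]; exists e, e, (sval e); split; first by split=> //; exact: corner_idem.
by case=> x /= /lidealP.
Qed.

Lemma is_rhoM (A B D : Sets S) (m : hom A B) (n : hom B D) :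
  is_lideal A -> is_lideal B -> is_lideal D ->
  is_rho m -> is_rho n -> is_rho (m ;; n).
Proof.
move=> _ _ _ [e [f [u [[Ae _ /cornerP[eu uf]] mE]]]].
move=> [f' [g [v [[_ Dg /cornerP[f'v vg]] nE]]]].
exists e, g, (u * v); split.
  by split=> //; apply/cornerP; rewrite mulgA eu -mulgA vg.
by move=> x /=; rewrite nE mE mulgA.
Qed.

Definition Lcat : category := subcat is_rho1 is_rhoM.

(* For S e <= S f the map rho(e,e,f) : x |-> x e is the inclusion of sets. *)
Definition Lincl (A B : Lcat) (m : hom A B) :=
  forall x : {x | sval A x},
    sval ((sval m : {x | sval A x} -> {x | sval B x}) x) = sval x.

Lemma Lhom_eq (A B : Lcat) (m n : hom A B) :
  (forall x : {x | sval A x},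
     sval ((sval m : {x | sval A x} -> {x | sval B x}) x) =
     sval ((sval n : {x | sval A x} -> {x | sval B x}) x)) -> m = n.
Proof.
move=> mn; apply: sval_inj; apply: funext => x.
by apply: sval_inj; exact: mn.
Qed.

Lemma Lincl_antisym (A B : Lcat) (m : hom A B) (n : hom B A) :
  Lincl m -> Lincl n -> A = B.
Proof.
move=> mi ni; apply: sval_inj; apply/seteqP; split=> x xA.
  by rewrite -[x](mi (exist _ x xA)); exact: svalP.
by rewrite -[x](ni (exist _ x xA)); exact: svalP.
Qed.

Program Definition L : catsub := @CatSub Lcat Lincl _ _ _ _ _ _.
Next Obligation. by []. Qed.
Next Obligation. by move=> A B D m n mi ni x; rewrite /= ni mi. Qed.
Next Obligation. by move=> A B m n mi ni; apply: Lhom_eq => x; rewrite mi ni. Qed.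
Next Obligation.
move=> A B m n mi ni _ _; have AB := Lincl_antisym mi ni; subst B.
have -> : m = idm A by apply: Lhom_eq => x; rewrite mi.
exact: IsIdentity.
Qed.
Next Obligation.
move=> A B m mi K h k hk; apply: Lhom_eq => x.
have /(congr1 sval) /= := congr1 (fun t : hom K B =>
  (sval t : {x | sval K x} -> {x | sval B x}) x) hk.
by rewrite !mi.
Qed.
Next Obligation. by move=> A B D h g hgi gi x; rewrite -[RHS](hgi x) /= gi. Qed.

Definition Lobj e : L := exist _ (lideal e) (ex_intro _ e erefl).

Lemma rho_subproof e u f (Hu : corner e u f) (x : {x | lideal e x}) :
  lideal f (sval x * u).
Proof. by case/cornerP: Hu => _ <-; exists (sval x * u); rewrite mulgA. Qed.

Definition rho_fun e u f (Hu : corner e u f) (x : {x | lideal e x}) :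
  {x | lideal f x} := exist _ (sval x * u) (rho_subproof Hu x).

Lemma rhoP e u f (Hu : corner e u f) :
  is_rho (rho_fun Hu : @hom (Sets S) (lideal e) (lideal f)).
Proof. by exists e, f, u. Qed.

Definition rho e u f (Hu : corner e u f) : hom (Lobj e) (Lobj f) :=
  exist _ (rho_fun Hu) (rhoP Hu).

Lemma Lstar_fix (a : S) f : Lstar a (sval f) -> a * sval f = a.
Proof. by move=> /(_ (Some (sval f)) None) [_]; apply; rewrite /= idemE. Qed.

(* The component at A of rho^a is x |-> x a; for A = S e this is
   rho(e,ea,f), see [principal_coneE]. *)
Lemma principal_subproof (a : S) f (af : Lstar a (sval f)) (A : set S)
  (x : {x | A x}) : lideal f (sval x * a).
Proof. by exists (sval x * a); rewrite -mulgA Lstar_fix. Qed.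

Definition principal_fun (a : S) f (af : Lstar a (sval f)) (A : set S)
  (x : {x | A x}) : {x | lideal f x} :=
  exist _ (sval x * a) (principal_subproof af x).

Lemma principal_corner (a : S) f (af : Lstar a (sval f)) e : corner e (sval e * a) f.
Proof. by exists a; rewrite -mulgA Lstar_fix // Lstar_fix. Qed.

Lemma principal_legP (a : S) f (af : Lstar a (sval f)) (A : L) :
  is_rho (@principal_fun a f af (sval A) : @hom (Sets S) (sval A) (lideal f)).
Proof.
have [e Ae] := svalP A; exists e, f, (sval e * a).
split; first by split=> //; exact: principal_corner.
by case=> x /=; rewrite Ae => /lidealP xe; rewrite mulgA xe.
Qed.

Definition principal_leg (a : S) f (af : Lstar a (sval f)) (A : L) : hom A (Lobj f) :=
  exist _ (@principal_fun a f af (sval A)) (principal_legP af A).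

Lemma principal_incl (a : S) f (af : Lstar a (sval f)) (A B : L) (j : hom A B) :
  incl j -> j ;; principal_leg af B = principal_leg af A.
Proof. by move=> ij; apply: Lhom_eq => x /=; rewrite ij. Qed.

Definition principal_cone (a : S) f (af : Lstar a (sval f)) : cone L :=
  Cone (principal_incl af).

Lemma principal_coneE (a : S) f (af : Lstar a (sval f)) e :
  leg (principal_cone af) (Lobj e) = rho (principal_corner af e).
Proof. by apply: Lhom_eq => -[x /= /lidealP xe]; rewrite mulgA xe. Qed.

Lemma Lstar_refl (a : S) : Lstar a a.
Proof. by []. Qed.

Lemma principal_id e :
  leg (principal_cone (Lstar_refl (sval e))) (Lobj e) = idm (Lobj e).
Proof. by apply: Lhom_eq => -[x /= /lidealP xe]. Qed.

Lemma principal_consistent e :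
  consistent_cone (principal_cone (Lstar_refl (sval e))).
Proof.
exists (Lobj e); rewrite principal_id.
by split=> K h k; rewrite ?compm1 ?comp1m.
Qed.

Definition rho_cone e : idem_cone L :=
  IdemCone (principal_consistent e) (principal_id e).

End L.

(* R(S) is L(S^opp): the principal right ideals e S are the principal left
   ideals of S^opp, and x |-> u x (u \in f S e) is right translation by u in
   S^opp, where u \in e S^opp f; similarly R^* is L^* in S^opp and the cones
   lambda^a are the cones rho^a of S^opp. *)
Definition R (S : semigroupType) : catsub := L S^opp.

Section R.
Variable S : semigroupType.
Implicit Types e f : idem S.

Definition idem_opp e : idem S^opp := exist _ (sval e) (svalP e).

Definition Robj e : R S := Lobj (idem_opp e).

Lemma corner_opp e u f :
  corner f u e -> corner (idem_opp e) (u : S^opp) (idem_opp f).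
Proof. by move=> [s ->]; exists s; rewrite -(mulgA (sval f) s). Qed.

Definition lam e u f (Hu : corner f u e) : hom (Robj e) (Robj f) :=
  rho (corner_opp Hu).

Lemma RobjE e (x : S) : sval (Robj e) x <-> exists y : S, x = sval e * y.
Proof. by []. Qed.

Lemma lamE e u f (Hu : corner f u e) (x : {x | sval (Robj e) x}) :
  sval (sval (lam Hu) x) = (u : S) * (sval x : S).
Proof. by []. Qed.

Definition lam_cone e : idem_cone (R S) := rho_cone (idem_opp e).

Lemma lam_coneE e f (x : {x | sval (Robj f) x}) :
  sval (sval (leg (lam_cone e) (Robj f)) x) = (sval e : S) * (sval x : S).
Proof. by []. Qed.

End R.

(** * The functors Gamma_S and Delta_S *)

Section CrossConnectionOfS.
Variable S : semigroupType.
Variables (HL : consistent_category (L S)) (HR : consistent_category (R S)).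

(* Every object of R(S) is some e S and every morphism some lambda(e,u,f), so
   there is at most one such functor. *)
Definition is_Gamma (Gam : functor (R S) (dual HL)) :=
  (forall e : idem S, Gam (Robj e) = dualH HL (rho_cone e)) /\
  (forall (e f : idem S) (u : S) (Hu : corner f u e),
     arrow (fmap Gam (lam Hu)) =
     @arrow (dual HL) (dualH HL (rho_cone e)) (dualH HL (rho_cone f))
       (@Htrans _ HL (rho_cone e) (rho_cone f) (rho Hu))).

Definition is_Delta (Del : functor (L S) (dual HR)) :=
  (forall e : idem S, Del (Lobj e) = dualH HR (lam_cone e)) /\
  (forall (e f : idem S) (u : S) (Hu : corner e u f),
     arrow (fmap Del (rho Hu)) =
     @arrow (dual HR) (dualH HR (lam_cone e)) (dualH HR (lam_cone f))
       (@Htrans _ HR (lam_cone e) (lam_cone f) (lam Hu))).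

End CrossConnectionOfS.

(* Main.v *)
From mathcomp Require Import all_boot all_classical.
Require Import Defs.

(** A morphism S e -> S f of L(S) is a right translation x |-> x u, and abundance
    turns properties of morphisms into properties of u: x |-> x u is a bimorphism
    exactly when e R* u L* f ([monoP], [epiP]). Consistent factorisations then
    come from idempotents R*- and L*-related to u, and normal factorisations of
    jq from the regularity of a product of two idempotents.

    The substantial part of the consistency of L(S) is that bimorphisms are
    consistent. The morphisms of the core of S e are the translations by elements
    of the subsemigroup <e> ([core_mor_gen], [gen_core_mor]). Idempotent-
    connectedness gives, for e R* u L* f, an isomorphism beta from <e> to <f> with
    x u = u beta(x) ([idempotent_connected_any]); the extension of T^u sends S g
    to S beta(g) and w to beta(w), and the translations by u are natural
    ([beta_functor_extension]). Uniqueness is a general fact about images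
    ([consistent_extension_uniq]). Since R(S) is L of the opposite semigroup and
    concordance is self-dual, R(S) is consistent too.

    For the cross-connection, the key point is that H(rho^e; S g) is the set of
    the principal cones rho^u with u in the intersection of e S and S g
    ([Hset_principal]). So H(rho^e; -) depends only on the right ideal e S, the
    transformation induced by v is rho^u |-> rho^(v u), inclusions of right
    ideals become inclusions of functors, and Yoneda gives full faithfulness. A
    subfunctor H(E; -) of H(rho^f; -) contains E, which forces E = rho^v with v an
    idempotent of f S; this is the local isomorphism property. Finally S g lies in
    M Gamma(e S) exactly when some idempotent v satisfies v S = e S and S v = S g
    ([Mset_Gamma]), a condition symmetric in the two sides.

    Gamma and Delta are both instances of one construction, attached to an
    anti-isomorphism o : S -> S': the identity from S to its opposite, and the
    identity back. This avoids comparing S with the opposite of its opposite,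
    which have the same product but different associativity proofs. *)

Set Implicit Arguments.
Unset Strict Implicit.
Unset Printing Implicit Defensive.

Local Open Scope classical_set_scope.
Local Open Scope group_scope.

Local Notation gen e := (generated (omega (sval e))).

(** * Morphisms of L(S) as right translations *)

Section Translations.
Variable S : semigroupType.
Implicit Types (e f g h : idem S) (A B D : L S) (u v w : S).

Lemma Lstar_cancel (a b x y : S) : Lstar a b -> a * x = a * y -> b * x = b * y.
Proof. by move=> /(_ (Some x) (Some y)) [ab _] /ab. Qed.

Lemma Rstar_cancel (a b x y : S) : Rstar a b -> x * a = y * a -> x * b = y * b.
Proof. by move=> /(_ (Some x) (Some y)) [ab _] /ab. Qed.

Lemma Rstar_fix (a : S) e : Rstar a (sval e) -> sval e * a = a.
Proof. by move=> /(_ (Some (sval e)) None) [_]; apply; rewrite /= idemE. Qed.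

(** For an idempotent [f] with [a f = a], the tests that involve the adjoined
    identity reduce to those with [f] in its place. *)
Lemma Lstar_idem (a : S) f : a * sval f = a ->
  (forall x y, a * x = a * y -> sval f * x = sval f * y) -> Lstar a (sval f).
Proof.
move=> af h.
have k (x y : option S) : mul1r a x = mul1r a y ->
    mul1r (sval f) x = mul1r (sval f) y.
  case: x y => [x|] [y|] //= H; last 2 first.
  - by have := h x (sval f); rewrite af idemE; apply.
  - by have := h (sval f) y; rewrite af idemE; apply.
  exact: h.
move=> x y; split; first exact: k.
have E z : mul1r a z = a * mul1r (sval f) z by case: z => [z|] /=; rewrite ?mulgA af.
by rewrite !E => ->.
Qed.

Lemma Rstar_idem (a : S) e : sval e * a = a ->
  (forall x y, x * a = y * a -> x * sval e = y * sval e) -> Rstar a (sval e).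
Proof.
move=> ea h.
have k (x y : option S) : mul1l x a = mul1l y a ->
    mul1l x (sval e) = mul1l y (sval e).
  case: x y => [x|] [y|] //= H; last 2 first.
  - by have := h x (sval e); rewrite ea idemE; apply.
  - by have := h (sval e) y; rewrite ea idemE; apply.
  exact: h.
move=> x y; split; first exact: k.
have E z : mul1l z a = mul1l z (sval e) * a by case: z => [z|] /=; rewrite -?mulgA ea.
by rewrite !E => ->.
Qed.

Definition to_idem u (uu : u * u = u) : idem S := exist (fun x : S => x * x = x) u uu.

Definition ap A B (m : hom A B) (x : {x | sval A x}) : S :=
  sval ((sval m : {x | sval A x} -> {x | sval B x}) x).

(** Every morphism of [L S] acts as [x |-> x u], but [u] is not unique: it
    matters only up to left multiplication by a generator of the domain. Working
    with this relation rather than with [rho] makes statements independent of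
    the idempotents that represent the objects. *)
Definition acts A B (m : hom A B) u := forall x, ap m x = sval x * u.

Lemma LobjP A : exists e, A = Lobj e.
Proof. by case: A => A [e Ae]; exists e; exact: eq_exist. Qed.

Lemma Lobj_eqP e f :
  Lobj e = Lobj f <-> sval e * sval f = sval e /\ sval f * sval e = sval f.
Proof.
split=> [/(congr1 sval) /= ef|[ef fe]].
  have [Ee Ff] := (proj2 (lidealP e _) (idemE e), proj2 (lidealP f _) (idemE f)).
  by split; apply/lidealP; [rewrite -ef | rewrite ef].
apply: eq_exist; apply/seteqP; split=> x /lidealP <-; apply/lidealP;
  by rewrite -mulgA ?ef ?fe.
Qed.

(** A morphism out of [S e] is determined by its value at [e]. *)
Definition at_idem e : {x | sval (Lobj e) x} :=
  exist _ (sval e) (proj2 (lidealP e (sval e)) (idemE e)).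

Lemma mem_Lobj e (x : {x | sval (Lobj e) x}) : sval x * sval e = sval x.
Proof. exact/lidealP/(svalP x). Qed.

Lemma ap_mem A f (m : hom A (Lobj f)) x : ap m x * sval f = ap m x.
Proof. exact: mem_Lobj. Qed.

Lemma acts_rho e u f (Hu : corner e u f) : acts (rho Hu) u.
Proof. by []. Qed.

Lemma hom_acts A B (m : hom A B) : exists u, acts m u.
Proof. by have [e [f [u [_ mu]]]] := svalP m; exists u. Qed.

Lemma acts_corner e f (m : hom (Lobj e) (Lobj f)) :
  exists u, corner e u f /\ acts m u.
Proof.
have [v mv] := hom_acts m.
exists (sval e * v); split; last by move=> x; rewrite mulgA mem_Lobj.
apply/cornerP; split; first by rewrite mulgA idemE.
by rewrite -[_ * v](mv (at_idem e)); exact: ap_mem.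
Qed.

Lemma acts_cornerE e f (m : hom (Lobj e) (Lobj f)) u :
  acts m u -> sval e * u * sval f = sval e * u.
Proof. by move=> mu; rewrite -[_ * u](mu (at_idem e)); exact: ap_mem. Qed.

Lemma acts_eq A B (m n : hom A B) u : acts m u -> acts n u -> m = n.
Proof. by move=> mu nu; apply: Lhom_eq => x; rewrite [LHS]mu [RHS]nu. Qed.

Lemma acts_comp A B D (m : hom A B) (n : hom B D) u v :
  acts m u -> acts n v -> acts (m ;; n) (u * v).
Proof. by move=> mu nv x; rewrite mulgA -mu; exact: nv. Qed.

Lemma acts_idm e : acts (idm (Lobj e)) (sval e).
Proof. by move=> x; rewrite mem_Lobj. Qed.

Lemma acts_inj e B (m : hom (Lobj e) B) u v :
  acts m u -> acts m v -> sval e * u = sval e * v.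
Proof. by move=> mu mv; rewrite -[LHS](mu (at_idem e)) [LHS]mv. Qed.

Lemma acts_shift e B (m : hom (Lobj e) B) u v :
  acts m u -> sval e * u = sval e * v -> acts m v.
Proof. by move=> mu uv x; rewrite mu -[sval x]mem_Lobj -!mulgA uv. Qed.

Lemma acts_exists A B u : (forall x, sval A x -> sval B (x * u)) ->
  exists m : hom A B, acts m u.
Proof.
have [[e ->] [f ->]] := (LobjP A, LobjP B) => h.
have euf : corner e (sval e * u) f.
  apply/cornerP; split; first by rewrite mulgA idemE.
  by apply/lidealP; apply: h; exact: (svalP (at_idem e)).
by exists (rho euf) => x; rewrite acts_rho mulgA mem_Lobj.
Qed.

Lemma incl_acts e B (j : hom (Lobj e) B) : incl j <-> acts j (sval e).
Proof. by split=> h x; [rewrite mem_Lobj; exact: h|rewrite -[RHS]mem_Lobj -h]. Qed.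

Lemma subobjP A B : @subobj (L S) A B <-> sval A `<=` sval B.
Proof.
split=> [[j ij] x Ax|AB].
  by rewrite -[x](ij (exist _ x Ax)); exact: svalP.
have [e Ae] := LobjP A; subst A.
have [j je] : exists j : hom (Lobj e) B, acts j (sval e).
  by apply: acts_exists => x /[dup] /AB Bx /lidealP ->.
by exists j; apply/incl_acts.
Qed.

Lemma Lobj_sub e f : sval (Lobj e) `<=` sval (Lobj f) <-> sval e * sval f = sval e.
Proof.
split=> [/(_ _ (svalP (at_idem e))) /lidealP //|ef x /lidealP <-].
by apply/lidealP; rewrite -mulgA ef.
Qed.

Lemma retractionP e f (q : hom (Lobj e) (Lobj f)) u : acts q u ->
  retraction q <-> sval f * sval e = sval f /\ sval f * u = sval f.
Proof.
move=> qu; split=> [[j /[dup] ij /incl_acts jf]|[fe fu]].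
  move=> jq; have fe : sval f * sval e = sval f.
    by apply/Lobj_sub/subobjP; exists j.
  split=> //; have := acts_comp jf qu; rewrite jq => /acts_inj /(_ (@acts_idm f)).
  by rewrite mulgA !idemE.
have [j ij] : subobj (Lobj f : L S) (Lobj e) by apply/subobjP/Lobj_sub.
exists j => //; apply: (@acts_eq _ _ _ _ (sval f)); last exact: acts_idm.
by rewrite -fu; apply: acts_comp => //; exact/incl_acts.
Qed.

End Translations.

(** * Cancellable morphisms and factorisations *)

Section Abundant.
Variable S : semigroupType.
Hypothesis abS : abundant S.
Implicit Types (e f g h : idem S) (A B D : L S) (u v w : S).

Lemma Lstar_idem_exists u : exists f : idem S, Lstar u (sval f).
Proof. by have [f ff uf] := abS.1 u; exists (to_idem ff). Qed.

(** As [e u = u], any idempotent [k] that is [R*]-related to [u] satisfies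
    [e k = k], so [k e] is again an idempotent [R*]-related to [u], now below
    [e]. *)
Lemma Rstar_idem_below e u : sval e * u = u ->
  exists2 h : idem S, Rstar u (sval h) &
    sval e * sval h = sval h /\ sval h * sval e = sval h.
Proof.
move=> eu; have [k0 kk uk0] := abS.2 u; pose k : idem S := to_idem kk.
have uk : Rstar u (sval k) by [].
have ek : sval e * sval k = sval k.
  by have [+ _] := uk (Some (sval e)) None; apply.
have hh : sval k * sval e * (sval k * sval e) = sval k * sval e.
  by rewrite !mulgA -(mulgA (sval k)) ek idemE.
exists (to_idem hh) => /=; last by rewrite -mulgA idemE mulgA ek.
apply: (@Rstar_idem _ _ (to_idem hh)) => /= [|x y xy].
  by rewrite -mulgA eu; exact: (Rstar_fix uk).
by rewrite !mulgA (Rstar_cancel uk xy).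
Qed.

(** The relation [R*] tests [u] against all of [S^1], whereas cancellability in
    [L S] only sees right translations. The gap is closed by
    [Rstar_idem_below]: the idempotents [h <= e] and [e] give two
    endomorphisms of [S e] with the same composite with [x |-> x u], so a
    monomorphism forces [h = e]. *)
Lemma monoP e B (m : hom (Lobj e) B) u : acts m u -> sval e * u = u ->
  mono m <-> Rstar u (sval e).
Proof.
move=> mu eu; split=> [mm|ue D h k hk].
  have [h uh [eh he]] := Rstar_idem_below eu.
  have [n nh] : exists n : hom (Lobj e) (Lobj e), acts n (sval h).
    by apply: acts_exists => x _; apply/lidealP; rewrite -mulgA he.
  suff /(acts_inj nh) : acts n (sval e) by rewrite eh idemE => <-.
  have -> : n = idm (Lobj e); last exact: acts_idm.
  apply: mm; rewrite comp1m; apply: (acts_eq _ mu).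
  by have := acts_comp nh mu; rewrite Rstar_fix.
have [g Dg] := LobjP D; subst D.
have [v [/cornerP[gv ve] hv]] := acts_corner h.
have [w [/cornerP[gw we] kw]] := acts_corner k.
have /acts_inj /(_ (acts_comp kw mu)) : acts (k ;; m) (v * u).
  by rewrite -hk; exact: acts_comp.
rewrite !mulgA gv gw => /(Rstar_cancel ue); rewrite ve we => vw.
by apply: acts_eq hv _; rewrite vw.
Qed.

(** As for [monoP]: if [l] is an idempotent [L*]-related to [u], the endomorphisms
    of [S f] given by [l] and by [f] agree after [x |-> x u]. *)
Lemma epiP e f (m : hom (Lobj e) (Lobj f)) u : acts m u -> sval e * u = u ->
  epi m <-> Lstar u (sval f).
Proof.
move=> mu eu.
have uf : u * sval f = u by rewrite -eu (acts_cornerE mu).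
split=> [me|uf' D h k hk].
  have [l ul] := Lstar_idem_exists u.
  have lf : sval l * sval f = sval l.
    by have [+ _] := ul (Some (sval f)) None; apply.
  have [n nl] : exists n : hom (Lobj f) (Lobj f), acts n (sval l).
    by apply: acts_exists => x _; apply/lidealP; rewrite -mulgA lf.
  have fl : sval f * sval l = sval f.
    suff /(acts_inj nl) : acts n (sval f) by rewrite idemE.
    have -> : n = idm (Lobj f); last exact: acts_idm.
    apply: me; rewrite compm1; apply: (acts_eq _ mu).
    by have := acts_comp mu nl; rewrite Lstar_fix.
  apply: Lstar_idem => // x y /(Lstar_cancel ul) lxy.
  by rewrite -fl -!mulgA lxy.
have [v hv] := hom_acts h; have [w kw] := hom_acts k.
have muw : acts (m ;; h) (u * w) by rewrite hk; exact: acts_comp.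
have := acts_inj (acts_comp mu hv) muw.
rewrite !mulgA eu => /(Lstar_cancel uf') vw.
by apply: acts_eq kw; exact: acts_shift hv vw.
Qed.

(** The image of [x |-> x u] on [S e] is [S l] for any idempotent [l] that is
    [L*]-related to [e u]: retract onto [S h] with [h <= e] and [h] [R*]-related
    to [e u]; what remains is a bimorphism by [monoP] and [epiP]. *)
Lemma epi_component_acts A B D (m : hom A B) (p : hom A D) u :
  acts m u -> acts p u -> epi p -> epi_component m p.
Proof.
have [[[e Ae] [f Bf]] [l Dl]] := (LobjP A, LobjP B, LobjP D); subst A B D.
move=> mu0 pu0.
pose v := sval e * u; have ev : sval e * v = v by rewrite mulgA idemE.
have {mu0} mu : acts m v by apply: acts_shift mu0 _; rewrite ev.
have {pu0} pu : acts p v by apply: acts_shift pu0 _; rewrite ev.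
clearbody v; clear u => pe.
have vl : Lstar v (sval l) by apply/(epiP pu ev).
have [h vh [eh he]] := Rstar_idem_below ev.
have vf : v * sval f = v by rewrite -ev (acts_cornerE mu).
have lf : sval l * sval f = sval l.
  by have [+ _] := vl (Some (sval f)) None; apply.
have [q qh] : exists q : hom (Lobj e) (Lobj h), acts q (sval h).
  by apply: acts_exists => x _; apply/lidealP; rewrite -mulgA idemE.
have [n nv] : exists n : hom (Lobj h) (Lobj l), acts n v.
  by apply: acts_exists => x _; apply/lidealP; rewrite -mulgA Lstar_fix.
have [j jl] : exists j : hom (Lobj l) (Lobj f), acts j (sval l).
  by apply: acts_exists => x _; apply/lidealP; rewrite -mulgA lf.
have hv : sval h * v = v by exact: Rstar_fix.
exists (Lobj h), q, n, j; split.
  split; last exact/incl_acts.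
  - by apply/(retractionP qh); rewrite he idemE.
  - by split; [apply/(monoP nv hv)|apply/(epiP nv hv)].
split.
  by apply: (acts_eq pu); have := acts_comp qh nv; rewrite hv.
apply: (acts_eq mu); have := acts_comp (acts_comp qh nv) jl.
by rewrite hv Lstar_fix.
Qed.

Lemma L_splits A B (j : hom A B) : incl j -> splits j.
Proof.
have [[e Ae] [f Bf]] := (LobjP A, LobjP B); subst A B => ij.
have je := (incl_acts j).1 ij.
have [q qe] : exists q : hom (Lobj f) (Lobj e), acts q (sval e).
  by apply: acts_exists => x _; apply/lidealP; rewrite -mulgA idemE.
exists q; apply: acts_eq (@acts_idm _ e).
by have := acts_comp je qe; rewrite idemE.
Qed.

Lemma L_factor A B (m : hom A B) : has_consistent_factorisation m.
Proof.
have [[e Ae] [f Bf]] := (LobjP A, LobjP B); subst A B.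
have [u [/cornerP[eu uf] mu]] := acts_corner m.
have [l ul] := Lstar_idem_exists u.
have [p pu] : exists p : hom (Lobj e) (Lobj l), acts p u.
  by apply: acts_exists => x _; apply/lidealP; rewrite -mulgA Lstar_fix.
by exists (Lobj l), p; apply: (epi_component_acts mu pu); apply/(epiP pu eu).
Qed.

(** The composite [jq] acts as [a = e u], a product of two idempotents. If
    [a y a = a] then [h = a y e] and [l = u y a] are idempotents with
    [h R a L l], and [l y h] inverts [a] from [S h] to [S l]. *)
Lemma L_normal (reg : forall e f : idem S, exists y,
      sval e * sval f * y * (sval e * sval f) = sval e * sval f)
    A B D (j : hom A B) (q : hom B D) :
  incl j -> retraction q -> has_normal_factorisation (j ;; q).
Proof.
have [[[e Ae] [f Bf]] [g Dg]] := (LobjP A, LobjP B, LobjP D); subst A B D.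
move=> /incl_acts je qr.
have [u [/cornerP[fu ug] qu]] := acts_corner q.
have [gf gu] := (retractionP qu).1 qr.
have uu : u * u = u by rewrite -{1}ug -mulgA gu ug.
have [y] := reg e (to_idem uu); rewrite /=.
move aE : (sval e * u) => a aya.
have ea : sval e * a = a by rewrite -aE mulgA idemE.
have au : a * u = a by rewrite -aE -mulgA uu.
have ag : a * sval g = a by rewrite -aE -mulgA ug.
have hh : a * y * sval e * (a * y * sval e) = a * y * sval e.
  by rewrite !mulgA -(mulgA _ (sval e)) ea aya.
have ll : u * y * a * (u * y * a) = u * y * a.
  by rewrite !mulgA -(mulgA _ a) au -!mulgA (mulgA a) aya.
have [h hE] : exists h : idem S, sval h = a * y * sval e by exists (to_idem hh).
have [l lE] : exists l : idem S, sval l = u * y * a by exists (to_idem ll).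
have ha : sval h * a = a by rewrite hE -mulgA ea.
have al : a * sval l = a by rewrite lE !mulgA au.
have eh : sval e * sval h = sval h by rewrite hE !mulgA ea.
have he : sval h * sval e = sval h by rewrite hE -mulgA idemE.
pose b := sval l * y * sval h.
have ab : a * b = sval h by rewrite /b !mulgA al hE !mulgA aya.
have ba : b * a = sval l.
  by rewrite /b -!mulgA ha lE -!mulgA (mulgA a) aya.
have bh : b * sval h = b by rewrite /b -!mulgA idemE.
have [r rh] : exists r : hom (Lobj e) (Lobj h), acts r (sval h).
  by apply: acts_exists => x _; apply/lidealP; rewrite -mulgA idemE.
have [n na] : exists n : hom (Lobj h) (Lobj l), acts n a.
  by apply: acts_exists => x _; apply/lidealP; rewrite -mulgA al.
have [n' nb] : exists n : hom (Lobj l) (Lobj h), acts n b.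
  by apply: acts_exists => x _; apply/lidealP; rewrite -mulgA bh.
have [i il] : exists i : hom (Lobj l) (Lobj g), acts i (sval l).
  by apply: acts_exists => x _; apply/lidealP; rewrite -mulgA lE -(mulgA (u * y)) ag.
exists (Lobj h), (Lobj l), r, n, i; split.
  split; last exact/incl_acts.
  - by apply/(retractionP rh); rewrite he idemE.
  exists n'; split.
    by apply: acts_eq (@acts_idm _ h); have := acts_comp na nb; rewrite ab.
  by apply: acts_eq (@acts_idm _ l); have := acts_comp nb na; rewrite ba.
apply: (acts_eq (acts_comp je qu)); rewrite aE.
by have := acts_comp (acts_comp rh na) il; rewrite ha al.
Qed.

End Abundant.

(** * The subsemigroups <e> and the core of an object *)

Section Generated.
Variable S : semigroupType.
Implicit Types (e f g h : idem S) (A B D : L S) (x y u v w : S).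

Lemma generated_sub (X : set S) x : X x -> generated X x.
Proof. by move=> Xx Y [_]; apply. Qed.

Lemma generatedM (X : set S) x y :
  generated X x -> generated X y -> generated X (x * y).
Proof. by move=> xX yX Y YX; apply: (YX.1); [exact: (xX Y)|exact: (yX Y)]. Qed.

Lemma generated_ind (X P : set S) :
  (forall x, X x -> P x) -> (forall x y, P x -> P y -> P (x * y)) ->
  forall x, generated X x -> P x.
Proof. by move=> XP PM x; apply; split=> // y z; exact: PM. Qed.

Lemma generated_fix e x : gen e x -> sval e * x = x /\ x * sval e = x.
Proof.
move: x; apply: generated_ind => [x [_ []] //|x y [ex _] [_ ye]].
by rewrite mulgA ex -mulgA ye.
Qed.

Lemma omega_unit e : omega (sval e) (sval e).
Proof. by split; [exact: idemE|rewrite idemE]. Qed.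

Lemma generated_unit e : gen e (sval e).
Proof. by apply: generated_sub; exact: omega_unit. Qed.

(** For [e R f], every [x] in [<e>] satisfies [f x = x]. So right multiplication by
    [f] is multiplicative on [<e>], and it sends [omega e] into [omega f]. *)
Lemma generated_R e f x : sval e * sval f = sval f -> sval f * sval e = sval e ->
  gen e x -> gen f (x * sval f).
Proof.
move=> ef fe xe.
suff [] : sval e * x = x /\ gen f (x * sval f) by [].
move: x xe; apply: generated_ind => [x [xx [xe ex]]|x y [ex xf] [ey yf]].
  split=> //; apply: generated_sub.
  have fx : sval f * x = x by rewrite -ex mulgA fe.
  split; last by rewrite -mulgA idemE mulgA fx.
  by rewrite /idempotents /= !mulgA -(mulgA x) fx xx.
have fy : sval f * y = y by rewrite -ey mulgA fe.
split; first by rewrite mulgA ex.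
by rewrite -mulgA -fy mulgA mulgA -mulgA; exact: generatedM.
Qed.

(** The left-right dual of [generated_R], with [e L f]. *)
Lemma generated_L e f x : sval e * sval f = sval e -> sval f * sval e = sval f ->
  gen e x -> gen f (sval f * x).
Proof.
move=> ef fe xe.
suff [] : x * sval e = x /\ gen f (sval f * x) by [].
move: x xe; apply: generated_ind => [x [xx [xe ex]]|x y [xe xf] [ye yf]].
  split=> //; apply: generated_sub.
  have fx : x * sval f = x by rewrite -xe -mulgA ef.
  split; last by rewrite mulgA idemE -mulgA fx.
  by rewrite /idempotents /= !mulgA -(mulgA (sval f)) fx -mulgA xx.
have fx : x * sval f = x by rewrite -xe -mulgA ef.
split; first by rewrite -mulgA ye.
have -> : sval f * (x * y) = sval f * x * (sval f * y) by rewrite -mulgA (mulgA x) fx.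
exact: generatedM xf yf.
Qed.

(** Idempotent-connectedness provides one pair of idempotents for each [u].
    Another pair [e R* u], [f L* u] is [R]- and [L]-related to it, so
    [generated_R] and [generated_L] carry the correspondence over. Stated as a
    relation, it needs no bijection: [x u = u y] determines each of [x] in [<e>]
    and [y] in [<f>] by the other. *)
Lemma idempotent_connected_any (icS : idempotent_connected S) u e f :
    Rstar u (sval e) -> Lstar u (sval f) ->
  (forall x, gen e x -> exists2 y, gen f y & x * u = u * y) /\
  (forall y, gen f y -> exists2 x, gen e x & x * u = u * y).
Proof.
move=> ue uf.
have [r0 [l0 [[rr ur ll ul] [al [[al' alK al'K] alE]]]]] := icS u.
have [r rE] : exists r : idem S, sval r = r0 by exists (to_idem rr).
have [l lE] : exists l : idem S, sval l = l0 by exists (to_idem ll).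
subst r0 l0.
have er : sval e * sval r = sval r.
  by apply: Rstar_fix => x y; rewrite -ue -ur.
have re : sval r * sval e = sval e.
  by apply: Rstar_fix => x y; rewrite -ue -ur.
have fl : sval f * sval l = sval f.
  by apply: Lstar_fix => x y; rewrite -ul -uf.
have lf : sval l * sval f = sval l.
  by apply: Lstar_fix => x y; rewrite -ul -uf.
split=> [x xe|y yf].
  have xr := generated_R er re xe; pose z := al (exist _ _ xr).
  exists (sval f * sval z); first exact: generated_L (svalP z).
  by rewrite mulgA Lstar_fix // -alE /= -mulgA Rstar_fix.
have yl := generated_L fl lf yf; pose z := al' (exist _ _ yl).
exists (sval z * sval e); first exact: generated_R (svalP z).
by rewrite -mulgA Rstar_fix // alE al'K /= mulgA Lstar_fix.
Qed.

Lemma subobj_omega e A : subobj A (Lobj e) ->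
  exists g, omega (sval e) (sval g) /\ A = Lobj g.
Proof.
have [k ->] := LobjP A => /subobjP /Lobj_sub ke.
have gg : sval e * sval k * (sval e * sval k) = sval e * sval k.
  by rewrite !mulgA -(mulgA _ (sval k)) ke -mulgA idemE.
exists (to_idem gg); split; last first.
  by apply/Lobj_eqP; rewrite /= mulgA ke idemE -mulgA idemE.
by split=> //=; rewrite -mulgA ke mulgA idemE.
Qed.

Lemma omega_subobj e g : omega (sval e) (sval g) -> subobj (Lobj g) (Lobj e).
Proof. by case=> _ [ge _]; apply/subobjP/Lobj_sub. Qed.

(** Inclusions act as [e] and retractions onto subobjects of [S e] as elements of
    [omega e]. *)
Lemma core_mor_gen e A B (m : hom A B) :
  core_mor (Lobj e) m -> exists2 w, gen e w & acts m w.
Proof.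
elim=> {A B m} [A B j Ae _ ij|A B q Ae Be qr|A B D m n _ [v ve mv] _ [w we nw]].
- exists (sval e); first exact: generated_unit.
  move=> x; rewrite [LHS]ij; symmetry; apply/lidealP.
  by move/subobjP: Ae; apply; exact: svalP.
- have [g [ge Ag]] := subobj_omega Ae; have [h [he Bh]] := subobj_omega Be; subst A B.
  have [v [/cornerP[gv vh] qv]] := acts_corner q.
  have [hg hv] := (retractionP qv).1 qr.
  exists v => //; apply: generated_sub; split.
    by rewrite /idempotents /= -{1}vh -mulgA hv vh.
  case: ge he => _ [ge eg] [_ [he eh]].
  by split; [rewrite -vh -mulgA he|rewrite -gv mulgA eg].
- by exists (v * w); [exact: generatedM|exact: acts_comp].
Qed.

(** Conversely, a product [g1 g2 ... gn] of elements of [omega e] acts as the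
    composite through [S g1], [S g2], ..., each step being an inclusion into
    [S e] followed by a retraction. *)
Lemma gen_core_mor e A B (m : hom A B) w :
  subobj A (Lobj e) -> subobj B (Lobj e) -> gen e w -> acts m w ->
  core_mor (Lobj e) m.
Proof.
move=> Ae Be we mw.
have ee : subobj (Lobj e) (Lobj e) by apply/subobjP.
suff main : forall w, gen e w -> forall A (n : hom A (Lobj e)),
    subobj A (Lobj e) -> acts n w -> core_mor (Lobj e) n.
  have [h [he Bh]] := subobj_omega Be; subst B.
  have [n nw] : exists n : hom A (Lobj e), acts n w.
    by apply: acts_exists => x _; apply/lidealP; rewrite -mulgA (generated_fix we).2.
  have [q qh] : exists q : hom (Lobj e) (Lobj h), acts q (sval h).
    by apply: acts_exists => x _; apply/lidealP; rewrite -mulgA idemE.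
  suff -> : m = n ;; q.
    apply: core_comp; first exact: main nw.
    apply: core_retr => //; apply/(retractionP qh); rewrite idemE.
    by case: he => _ [].
  apply: (@acts_eq _ _ _ _ _ (w * sval h)); last exact: acts_comp.
  by move=> x; rewrite mulgA -mw; symmetry; exact: ap_mem.
move=> {A B m Ae Be mw w we} w we.
suff [] : w * sval e = w /\ forall A (n : hom A (Lobj e)),
    subobj A (Lobj e) -> acts n w -> core_mor (Lobj e) n by [].
move: w we; apply: generated_ind => [v ve|v w [ve IHv] [wwe IHw]].
  split=> [|A n Ae nv]; first by case: ve => _ [].
  have [vv [ev' ev]] := ve.
  pose k : idem S := to_idem vv.
  have [i iv] : exists i : hom (Lobj k) (Lobj e), acts i (sval k).
    apply: acts_exists => x /lidealP; rewrite /= => xv.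
    by apply/lidealP; rewrite xv -xv -mulgA ev'.
  have [j je] : exists j : hom A (Lobj e), acts j (sval e).
    by apply: acts_exists => x _; apply/lidealP; rewrite -mulgA idemE.
  have [q qv] : exists q : hom (Lobj e) (Lobj k), acts q v.
    by apply: acts_exists => x _; apply/lidealP; rewrite -mulgA /= vv.
  have ke : subobj (Lobj k) (Lobj e) by exact: omega_subobj.
  have -> : n = j ;; q ;; i.
    apply: (acts_eq nv); have := acts_comp (acts_comp je qv) iv.
    by rewrite ev /= vv.
  apply: core_comp; last by apply: core_incl => //; apply/incl_acts.
  apply: core_comp.
    apply: core_incl => // x; rewrite [LHS]je; apply/lidealP.
    by move/subobjP: Ae; apply; exact: svalP.
  by apply: core_retr => //; apply/(retractionP qv).
split=> [|A n Ae nvw]; first by rewrite -mulgA wwe.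
have [i iv] : exists i : hom A (Lobj e), acts i v.
  by apply: acts_exists => x _; apply/lidealP; rewrite -mulgA ve.
have [j jw] : exists j : hom (Lobj e) (Lobj e), acts j w.
  by apply: acts_exists => x _; apply/lidealP; rewrite -mulgA wwe.
rewrite (acts_eq nvw (acts_comp iv jw)).
by apply: core_comp; [exact: IHv|exact: IHw].
Qed.

End Generated.

(** * Every bimorphism of L(S) is consistent *)

Lemma inj_surj_bijective (X Y : Type) (k : X -> Y) :
  injective k -> (forall y, exists x, k x = y) -> bijective k.
Proof.
move=> ki /choice [k' k'K]; exists k' => // x.
by apply: ki; rewrite k'K.
Qed.

(** Images are unique, so two extensions agree on objects and their natural
    transformations have the same components. These are epimorphisms, and
    naturality then determines the functor on morphisms. *)
Lemma consistent_extension_uniq (C : catsub)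
    (sp : forall (a b : C) (j : hom a b), incl j -> splits j)
    (c d : C) (u : hom c d) (T T' : functor (core c) (core d)) :
  consistent_extension u T -> consistent_extension u T' -> T = T'.
Proof.
move=> [_ _ _ [t tP]] [_ _ _ [t' t'P]].
have tt' (x : core c) : arrow (t x) = arrow (t' x).
  have [j ij] := svalP x.
  exact: (epi_component_uniq sp (tP _ _ ij) (t'P _ _ ij)).
have TT' : fobj T = fobj T'.
  by apply: funext => x; apply: sval_inj; exact: arrow_cod (tt' x).
case: T T' t tP t' t'P tt' TT' => [T Tm T1 TM] [T' T'm T'1 T'M] /=.
move=> t tP t' t'P tt' E; subst T'.
have TmT' : Tm = T'm.
  apply: functional_extensionality_dep => x.
  apply: functional_extensionality_dep => y.
  apply: funext => m; apply: sval_inj.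
  have [j ij] := svalP x.
  apply: (epi_component_epi (tP x j ij)).
  have /= <- := nt_nat t m.
  rewrite (arrow_inj (tt' x)) (arrow_inj (tt' y)).
  exact: (nt_nat t' m).
by subst T'm; congr Functor; exact: Prop_irrelevance.
Qed.

Section Extension.
Variable S : semigroupType.
Hypothesis abS : abundant S.
Implicit Types (g h : idem S) (A B D : L S) (v w : S).
Variables (e f : idem S) (u : S).
Hypotheses (ue : Rstar u (sval e)) (uf : Lstar u (sval f)).
Hypothesis fwd : forall x, gen e x -> exists2 y, gen f y & x * u = u * y.
Hypothesis bwd : forall y, gen f y -> exists2 x, gen e x & x * u = u * y.

(** The bijection [<e> -> <f>] that [u] induces. It is multiplicative because
    [u L* f] allows [u] to be cancelled in
    [u beta(x y) = u beta(x) beta(y)]. *)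
Definition beta x := xget x [set y | gen f y /\ x * u = u * y].

Lemma betaP x : gen e x -> gen f (beta x) /\ x * u = u * beta x.
Proof.
move=> xe; apply: (@xgetPex _ x [set y | gen f y /\ x * u = u * y]).
by have [y yf xu] := fwd xe; exists y.
Qed.

Lemma beta_uniq x y : gen e x -> gen f y -> x * u = u * y -> beta x = y.
Proof.
move=> xe yf xu; have [bf bu] := betaP xe.
have : u * beta x = u * y by rewrite -bu.
by move=> /(Lstar_cancel uf); rewrite (generated_fix bf).1 (generated_fix yf).1.
Qed.

Lemma betaM x y : gen e x -> gen e y -> beta (x * y) = beta x * beta y.
Proof.
move=> xe ye; have [xf xu] := betaP xe; have [yf yu] := betaP ye.
apply: beta_uniq; [exact: generatedM|exact: generatedM|].
by rewrite mulgA -xu -!mulgA yu.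
Qed.

Lemma beta_inj x y : gen e x -> gen e y -> beta x = beta y -> x = y.
Proof.
move=> xe ye xy; have [_ xu] := betaP xe; have [_ yu] := betaP ye.
have : x * u = y * u by rewrite xu yu xy.
by move=> /(Rstar_cancel ue); rewrite (generated_fix xe).2 (generated_fix ye).2.
Qed.

Lemma beta_surj y : gen f y -> exists2 x, gen e x & beta x = y.
Proof.
by move=> yf; have [x xe xu] := bwd yf; exists x => //; exact: beta_uniq.
Qed.

Lemma beta_omega x : omega (sval e) x -> omega (sval f) (beta x).
Proof.
move=> xe; have xe' : gen e x by apply: generated_sub.
have [xf _] := betaP xe'; have [fx xf'] := generated_fix xf.
by split=> //; rewrite /idempotents /= -betaM // xe.1.
Qed.

Lemma core_omega (x : core (Lobj e)) :
  exists g, omega (sval e) (sval g) /\ sval x = Lobj g.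
Proof. exact: subobj_omega (svalP x). Qed.

(** Objects of the core are sets; an idempotent of [omega e] that generates one is
    chosen here, as [beta] acts on elements. *)
Definition omega_rep (x : core (Lobj e)) : idem S := sval (cid (core_omega x)).

Lemma omega_repP x : omega (sval e) (sval (omega_rep x)) /\ sval x = Lobj (omega_rep x).
Proof. exact: svalP (cid (core_omega x)). Qed.

Lemma omega_rep_gen x : gen e (sval (omega_rep x)).
Proof. by apply: generated_sub; exact: (omega_repP x).1. Qed.

Lemma beta_omega_rep_idem x :
  beta (sval (omega_rep x)) * beta (sval (omega_rep x)) =
  beta (sval (omega_rep x)).
Proof. by rewrite -betaM ?idemE //; exact: omega_rep_gen. Qed.

Definition beta_rep x : idem S := to_idem (beta_omega_rep_idem x).

Lemma beta_rep_subobj x : subobj (Lobj (beta_rep x)) (Lobj f).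
Proof. by apply: omega_subobj; apply: beta_omega; exact: (omega_repP x).1. Qed.

Definition beta_obj (x : core (Lobj e)) : core (Lobj f) :=
  exist _ (Lobj (beta_rep x)) (beta_rep_subobj x).

Lemma omega_rep_mem x : sval (sval x) (sval (omega_rep x)).
Proof. by rewrite (omega_repP x).2; exact: svalP (at_idem (omega_rep x)). Qed.

Definition coef_core (x y : core (Lobj e)) (m : hom x y) : S :=
  ap (sval m) (exist _ (sval (omega_rep x)) (omega_rep_mem x)).

Lemma mul_omega_rep x (z : {z | sval (sval x) z}) : sval z * sval (omega_rep x) = sval z.
Proof. by case: z => z /=; rewrite (omega_repP x).2 => /lidealP. Qed.

Section Mor.
Variables (x y : core (Lobj e)) (m : hom x y).

Lemma coef_coreE w : acts (sval m) w -> coef_core m = sval (omega_rep x) * w.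
Proof. by move=> mw; exact: mw. Qed.

Lemma coef_core_acts : acts (sval m) (coef_core m).
Proof.
have [w mw] := hom_acts (sval m).
by move=> z; rewrite (coef_coreE mw) mulgA mul_omega_rep.
Qed.

Lemma coef_core_gen : gen e (coef_core m).
Proof.
have [w we mw] := core_mor_gen (svalP m).
by rewrite (coef_coreE mw); apply: generatedM => //; exact: omega_rep_gen.
Qed.

Lemma coef_core_left : sval (omega_rep x) * coef_core m = coef_core m.
Proof. by rewrite -[LHS](coef_coreE coef_core_acts). Qed.

Lemma coef_core_right : coef_core m * sval (omega_rep y) = coef_core m.
Proof. by rewrite /coef_core /ap mul_omega_rep. Qed.

Lemma beta_corner : corner (beta_rep x) (beta (coef_core m)) (beta_rep y).
Proof.
apply/cornerP; rewrite /= -!betaM ?coef_core_left ?coef_core_right //;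
  by [exact: omega_rep_gen|exact: coef_core_gen].
Qed.

Lemma beta_core : core_mor (Lobj f) (rho beta_corner).
Proof.
apply: (@gen_core_mor _ _ _ _ _ (beta (coef_core m))); try exact: beta_rep_subobj.
  by have [] := betaP coef_core_gen.
exact: acts_rho.
Qed.

Definition beta_mor : hom (beta_obj x) (beta_obj y) :=
  exist _ (rho beta_corner) beta_core.

End Mor.

Lemma beta_mor1 x : beta_mor (idm x) = idm (beta_obj x).
Proof.
by apply: sval_inj; apply: acts_eq (@acts_idm _ (beta_rep x)); exact: acts_rho.
Qed.

Lemma beta_morM x y z (m : hom x y) (n : hom y z) :
  beta_mor (m ;; n) = beta_mor m ;; beta_mor n.
Proof.
apply: sval_inj; apply: acts_eq (acts_comp _ _); try exact: acts_rho.
have -> : beta (coef_core m) * beta (coef_core n) = beta (coef_core (m ;; n)).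
  rewrite -betaM; try exact: coef_core_gen.
  have /coef_coreE -> : acts (sval (m ;; n)) (coef_core m * coef_core n).
    exact: acts_comp (coef_core_acts m) (coef_core_acts n).
  by rewrite mulgA coef_core_left.
exact: acts_rho.
Qed.

Definition beta_functor : functor (core (Lobj e)) (core (Lobj f)) :=
  Functor beta_mor1 beta_morM.

Lemma beta_obj_inj x y : beta_obj x = beta_obj y -> x = y.
Proof.
move=> /(congr1 sval) /Lobj_eqP /= [].
have [xe ye] := (omega_rep_gen x, omega_rep_gen y).
rewrite -!betaM // => /(beta_inj (generatedM xe ye) xe) xy.
move=> /(beta_inj (generatedM ye xe) ye) yx.
by apply: sval_inj; rewrite (omega_repP x).2 (omega_repP y).2; apply/Lobj_eqP.
Qed.

Lemma beta_obj_surj (y : core (Lobj f)) : exists x, beta_obj x = y.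
Proof.
have [k [kf yk]] := subobj_omega (svalP y).
have [g0 ge gk] : exists2 x, gen e x & beta x = sval k.
  by apply: beta_surj; exact: generated_sub.
have gg : g0 * g0 = g0.
  by apply: beta_inj => //; [exact: generatedM|rewrite betaM // gk idemE].
pose g := to_idem gg.
have gom : omega (sval e) (sval g) by have [] := generated_fix ge.
pose x : core (Lobj e) := exist _ (Lobj g) (omega_subobj gom).
exists x; apply: sval_inj; rewrite yk.
have /Lobj_eqP [/= e1 e2] := (omega_repP x).2.
by apply/Lobj_eqP; rewrite /= -gk -!betaM ?e1 ?e2 //; exact: omega_rep_gen.
Qed.

(** Core morphisms [S g -> S h] correspond to the elements of [<e>] fixed by [g] on
    the left and by [h] on the right, and [beta] is an isomorphism. *)
Lemma beta_fully_faithful : fully_faithful beta_functor.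
Proof.
move=> x y; apply: inj_surj_bijective => [m n|n].
  move=> mn; have nb : acts (sval (beta_mor m)) (beta (coef_core n)).
    by rewrite [beta_mor m]mn; exact: acts_rho.
  have := acts_inj (acts_rho (beta_corner m)) nb.
  have /cornerP [-> _] := beta_corner m; have /cornerP [-> _] := beta_corner n.
  move=> /(beta_inj (coef_core_gen m) (coef_core_gen n)) {}mn.
  apply: sval_inj; apply: (acts_eq (coef_core_acts m)); rewrite mn.
  exact: coef_core_acts.
have [z zf nz] := core_mor_gen (svalP n).
pose z' := beta (sval (omega_rep x)) * z.
have z'f : gen f z' by apply: generatedM => //; exact: (betaP (omega_rep_gen x)).1.
have nz' : acts (sval n) z'.
  by move=> t; rewrite nz /z' mulgA; congr (_ * _); rewrite (mem_Lobj (e := beta_rep x)).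
have z'y : z' * beta (sval (omega_rep y)) = z'.
  rewrite -[LHS](mulgA _ z) -[RHS](nz (at_idem (beta_rep x))).
  by rewrite -[RHS]ap_mem nz /= mulgA.
have [w we wz] := beta_surj z'f.
have wx : sval (omega_rep x) * w = w.
  apply: beta_inj => //; first by apply: generatedM => //; exact: omega_rep_gen.
  by rewrite betaM ?wz //; [rewrite /z' mulgA beta_omega_rep_idem|exact: omega_rep_gen].
have wy : w * sval (omega_rep y) = w.
  apply: beta_inj => //; first by apply: generatedM => //; exact: omega_rep_gen.
  by rewrite betaM ?wz //; exact: omega_rep_gen.
have [m mw] : exists m : hom (sval x) (sval y), acts m w.
  apply: acts_exists => t _; rewrite (omega_repP y).2.
  by apply/lidealP; rewrite -mulgA wy.
have mc : core_mor (Lobj e) m by exact: gen_core_mor (svalP x) (svalP y) we mw.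
exists (exist _ m mc); apply: sval_inj; apply: acts_eq nz'.
have -> : z' = beta (coef_core (exist _ m mc : hom x y)).
  by rewrite (@coef_coreE _ _ (exist _ m mc) w) // wx.
exact: acts_rho.
Qed.

(** As [g u = u beta(g)] and [u L* f], the image of [S g] under [u] is
    [S beta(g)]: this is why [beta] computes the functor T^u. *)
Lemma beta_rep_Lstar x : Lstar (sval (omega_rep x) * u) (sval (beta_rep x)).
Proof.
have [bf gu] := betaP (omega_rep_gen x).
apply: Lstar_idem => [|a b].
  by rewrite /= gu -mulgA -betaM ?idemE //; exact: omega_rep_gen.
rewrite gu -!mulgA => /(Lstar_cancel uf).
by rewrite !mulgA (generated_fix bf).1.
Qed.

Lemma image_leg_exists x : exists m : hom (sval x) (Lobj (beta_rep x)), acts m u.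
Proof.
apply: acts_exists => t; rewrite (omega_repP x).2 => /lidealP <-.
by apply/lidealP; rewrite -(mulgA t) -mulgA Lstar_fix //; exact: beta_rep_Lstar.
Qed.

Definition image_leg x := sval (cid (image_leg_exists x)).

Lemma image_leg_acts x : acts (image_leg x) u.
Proof. exact: svalP (cid (image_leg_exists x)). Qed.

Lemma image_leg_nat x y (m : hom x y) :
  fmap (core_functor (Lobj e)) m ;; image_leg y =
  image_leg x ;; fmap (functor_comp beta_functor (core_functor (Lobj f))) m.
Proof.
change (sval m ;; image_leg y = image_leg x ;; rho (beta_corner m)).
apply: (acts_eq (acts_comp (coef_core_acts m) (@image_leg_acts y))).
have [_ ->] := betaP (coef_core_gen m).
by apply: acts_comp; [exact: image_leg_acts|exact: acts_rho].
Qed.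

Definition image_trans : nat_trans (core_functor (Lobj e))
    (functor_comp beta_functor (core_functor (Lobj f))) :=
  @NatTrans _ _ (core_functor (Lobj e))
    (functor_comp beta_functor (core_functor (Lobj f))) image_leg image_leg_nat.

Lemma image_leg_epi x : epi (image_leg x).
Proof.
have := @image_leg_acts x; move: (image_leg x); rewrite (omega_repP x).2 => m mu.
apply/(@epiP _ abS _ _ m (sval (omega_rep x) * u)).
- by apply: acts_shift mu _; rewrite mulgA idemE.
- by rewrite mulgA idemE.
- exact: beta_rep_Lstar.
Qed.

(** The components [S g -> S beta(g)] of the natural transformation all act as
    [u] itself, and naturality at [w] is the equation [w u = u beta(w)]. *)
Lemma beta_functor_extension (m : hom (Lobj e) (Lobj f)) : acts m u ->
  consistent_extension m beta_functor.
Proof.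
move=> mu.
have legP (x : core (Lobj e)) (j : hom (sval x) (Lobj e)) : incl j ->
    epi_component (j ;; m) (image_leg x).
  move=> ij; apply: (@epi_component_acts _ abS _ _ _ _ _ u); last exact: image_leg_epi.
    by move=> t; rewrite [LHS]mu; congr (_ * _); exact: ij t.
  exact: image_leg_acts.
split.
- split; last exact: beta_fully_faithful.
  by apply: inj_surj_bijective; [exact: beta_obj_inj|exact: beta_obj_surj].
- by move=> x j ij; exists (image_leg x); exact: legP.
- move=> x y i ii; apply/incl_acts; rewrite /=.
  have -> : beta (sval (omega_rep x)) = beta (coef_core i) by congr beta; rewrite [RHS]ii.
  exact: acts_rho.
- by exists image_trans; exact: legP.
Qed.

End Extension.

(** * L(S) and R(S) are consistent *)

Lemma L_consistent (S : semigroupType) : concordant S -> consistent_category (L S).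
Proof.
move=> [abS icS regS]; split.
- exact: L_splits.
- exact: L_factor.
- move=> A B; have [e ->] := LobjP A; have [f ->] := LobjP B => m mb.
  split=> //; have [u [/cornerP[eu _] mu]] := acts_corner m.
  have ue : Rstar u (sval e) by apply/(monoP abS mu eu); case: mb.
  have uf : Lstar u (sval f) by apply/(epiP abS mu eu); case: mb.
  have [fwd bwd] := idempotent_connected_any icS ue uf.
  have mT := beta_functor_extension abS ue uf fwd bwd mu.
  exists (beta_functor uf fwd); split => // T; apply: consistent_extension_uniq mT.
  exact: L_splits.
- apply: L_normal => // e f.
  have [|y _ efy] := regS (sval e * sval f); last by exists y.
  by apply: generatedM; apply: generated_sub; exact: idemE.
- move=> c; have [e ->] := LobjP c; exists (rho_cone e).
  by split; [exact: principal_consistent|rewrite principal_id].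
Qed.

Lemma generated_opp (S : semigroupType) (X : set S) :
  generated (S := S^opp) X = generated X.
Proof.
by apply/seteqP; split=> x xX Y [YM XY]; apply: xX; split=> // y z yY zY; exact: YM.
Qed.

Lemma omega_opp (S : semigroupType) (e : S) : omega (S := S^opp) e = omega e.
Proof. by apply/seteqP; split=> x [xx [xe ex]]. Qed.

(** Every condition is self-dual; the connecting bijection is replaced by its
    inverse. *)
Lemma concordant_opp (S : semigroupType) : concordant S -> concordant S^opp.
Proof.
move=> [[abl abr] ic reg]; split.
- by split=> a; [have [e ee ae] := abr a|have [e ee ae] := abl a]; exists e.
- move=> a; have [r [l [[rr ar ll al] [alpha [[alpha' alK al'K] alE]]]]] := ic a.
  exists l, r; split; first by split.
  rewrite !omega_opp !generated_opp; exists alpha'; split; first by exists alpha.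
  by move=> z; have := alE (alpha' z); rewrite al'K => E; exact: esym E.
- have -> : generated (idempotents (S := S^opp)) = generated (idempotents (S := S)).
    exact: generated_opp.
  by move=> x /reg [y yE xyx]; exists y => //; rewrite -[RHS]xyx; symmetry; exact: mulgA.
Qed.

(** * The Yoneda lemma in the consistent dual *)

Section DualLemmas.
Variables (C : catsub) (HC : consistent_category C).

Lemma cone_ext (g h : cone C) : apex g = apex h ->
  (forall a, arrow (leg g a) = arrow (leg h a)) -> g = h.
Proof.
case: g h => [x l lP] [x' l' l'P] /= E; subst x' => ll'.
have El : l = l' by apply: functional_extensionality_dep => a; exact: arrow_inj.
by subst l'; congr Cone; exact: Prop_irrelevance.
Qed.

Lemma idem_cone_ext (g h : idem_cone C) : ic_cone g = ic_cone h -> g = h.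
Proof.
case: g h => [g gc gi] [h hc hi] /= E; subst h.
by congr IdemCone; exact: Prop_irrelevance.
Qed.

Lemma cone_star_arrow (g : cone C) (b d : C) (m : hom (apex g) b) (n : hom (apex g) d) :
  arrow m = arrow n -> cone_star m = cone_star n.
Proof. by move=> mn; have E := arrow_cod mn; subst d; rewrite (arrow_inj mn). Qed.

Lemma epart_arrow (a b d : C) (m : hom a b) (p : hom a d) :
  epi_component m p -> arrow (epart HC m) = arrow p.
Proof.
by move=> mp; apply: (epi_component_uniq (cc_splits HC) (epartP HC m) mp).
Qed.

(** The natural transformation induced by a morphism between apices, as a
    morphism of the consistent dual. *)
Definition dual_hom (e e' : idem_cone C) (m : hom (apex e') (apex e)) :
  hom (dualH HC e) (dualH HC e') := Htrans HC m.

Lemma dual_hom1 (e : idem_cone C) : dual_hom (idm (apex e)) = idm (dualH HC e).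
Proof.
by apply: nat_trans_eq => c; apply: funext => x /=; rewrite comp1m etaK.
Qed.

Lemma dual_homM (e e' e'' : idem_cone C) (m : hom (apex e') (apex e))
    (n : hom (apex e'') (apex e')) :
  dual_hom (n ;; m) = dual_hom m ;; dual_hom n.
Proof.
by apply: nat_trans_eq => c; apply: funext => x /=; rewrite eta_invK compA.
Qed.

Lemma dual_hom_inj (e e' : idem_cone C) : injective (@dual_hom e e').
Proof.
move=> m n mn.
pose T (t : nat_trans (Hfunctor HC e) (Hfunctor HC e')) :
  {g | Hset HC e (apex e) g} -> {g | Hset HC e' (apex e) g} := t (apex e).
have := congr1 (fun t => eta (T t (eta_inv HC (idm (apex e))))) mn.
by rewrite /T /= !eta_invK !compm1.
Qed.

(** Yoneda: a transformation is determined by its value at the element of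
    [H(e; c_e)] that corresponds to the identity. *)
Lemma dual_hom_surj (e e' : idem_cone C) (t : hom (dualH HC e) (dualH HC e')) :
  exists m, dual_hom m = t.
Proof.
pose T c : {g | Hset HC e c g} -> {g | Hset HC e' c g} :=
  (t : nat_trans (Hfunctor HC e) (Hfunctor HC e')) c.
pose i := eta_inv HC (idm (apex e)).
exists (eta (T _ i)); apply: nat_trans_eq => c; apply: funext => x /=.
have /= E := congr1 (fun k => k i)
  (nt_nat (t : nat_trans (Hfunctor HC e) (Hfunctor HC e')) (eta x)).
have {}E : eta_inv HC (eta (T _ i) ;; eta x) = T c (eta_inv HC (eta i ;; eta x)) by [].
by rewrite E /i eta_invK comp1m etaK.
Qed.

(** Transformations whose domains are equal without being convertible are compared
    on elements, as these belong to the same type of cones. *)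
Lemma dual_arrow (X X' Y Y' : dual HC) (s : hom X Y) (t : hom X' Y') :
  X = X' -> Y = Y' ->
  (forall c (x : {g | sval X c g}) (x' : {g | sval X' c g}), sval x = sval x' ->
    sval ((s : nat_trans (sval X) (sval Y)) c x) =
    sval ((t : nat_trans (sval X') (sval Y')) c x')) ->
  arrow s = arrow t.
Proof.
move=> EX EY; subst X' Y' => st; congr arrow.
by apply: nat_trans_eq => c; apply: funext => x; apply: sval_inj; exact: st.
Qed.

(** The idempotent cone [E] is the element of [H(E; c_E)] that corresponds to the
    identity; subfunctors will be recognised through it. *)
Lemma idem_cone_Hset (E : idem_cone C) : Hset HC E (apex E) E.
Proof.
exists (idm (apex E)).
have ii : epi_component (idm (apex E)) (idm (apex E)).
  exists (apex E), (idm _), (idm _), (idm _); rewrite !comp1m; split=> //; split.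
  - by exists (idm _); rewrite ?comp1m //; exact: incl1.
  - by split=> D h k; rewrite ?compm1 ?comp1m.
  - exact: incl1.
rewrite (cone_star_arrow (epart_arrow ii)).
by apply: cone_ext => // A /=; rewrite compm1.
Qed.

End DualLemmas.

(** * The functors H(rho^e;-) in terms of elements of S *)

Section DualOfL.
Variable S : semigroupType.
Hypothesis abS : abundant S.
Variable HL : consistent_category (L S).
Implicit Types (e f g h : idem S) (A B D c : L S) (u v w : S).

(** Idempotents that are [L*]-related to the same [u] are [L]-related, so they
    generate the same apex. *)
Lemma principal_cone_eq u v f g (uf : Lstar u (sval f)) (vg : Lstar v (sval g)) :
  u = v -> principal_cone uf = principal_cone vg.
Proof.
move=> uv; subst v.
have fg : Lobj f = Lobj g.
  by apply/Lobj_eqP; split; apply: Lstar_fix => x y; rewrite -uf -vg.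
apply: cone_ext => // A.
have L_arrow B (m : hom A (Lobj f)) (n : hom A B) : Lobj f = B ->
    acts m u -> acts n u -> arrow m = arrow n.
  by move=> E; subst B => mu nu; rewrite (acts_eq mu nu).
by apply: L_arrow.
Qed.

(** The value at [e] of the component at [S e]. For the principal cone of [u] it is
    [e u], so the cone determines [u] within any right ideal [e S], though not
    within [S] in general. *)
Definition leg_at (k : cone (L S)) e : S := ap (leg k (Lobj e)) (at_idem e).

Lemma principal_cone_inj u v f g (uf : Lstar u (sval f)) (vg : Lstar v (sval g)) :
  principal_cone uf = principal_cone vg ->
  forall e, sval e * u = sval e * v.
Proof. by move=> uv e; exact: (congr1 (leg_at^~ e) uv). Qed.

(** The image of [x |-> x u] is generated by an idempotent [L*]-related to [u], so
    the cone [rho^e * (rho(e,u,g))] with its epimorphic component is [rho^u]. *)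
Lemma cone_star_principal e B (m : hom (Lobj e) B) u f (uf : Lstar u (sval f)) :
  acts m u -> sval e * u = u ->
  cone_star (g := rho_cone e) (epart HL m) = principal_cone uf.
Proof.
move=> mu eu.
have euf : corner e u f by apply/cornerP; rewrite Lstar_fix.
have mp : epi_component m (rho euf).
  apply: (epi_component_acts abS mu (acts_rho euf)).
  exact/(epiP abS (acts_rho euf) eu).
rewrite (cone_star_arrow (g := rho_cone e) (epart_arrow HL mp)).
apply: cone_ext => // A; congr arrow.
by apply: Lhom_eq => x /=; rewrite -mulgA eu.
Qed.

(** H(rho^e; c) consists of the cones [rho^u] with [u] in the intersection of the
    right ideal [e S] and the left ideal [c]. In particular the functor depends
    only on the right ideal. *)
Lemma Hset_principal e c k : Hset HL (rho_cone e) c k <->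
  exists u f (uf : Lstar u (sval f)),
    [/\ sval e * u = u, sval c u & k = principal_cone uf].
Proof.
split=> [[m ->]|[u [f [uf [eu cu ->]]]]].
  have [g cg] := LobjP c; subst c.
  have [u [/cornerP[eu ug] mu]] := acts_corner m.
  have [f uf] := Lstar_idem_exists abS u; exists u, f, uf; split => //.
    exact/lidealP.
  exact: cone_star_principal.
have [m mu] : exists m : hom (Lobj e) c, acts m u.
  have [g cg] := LobjP c; subst c; move/lidealP: cu => ug.
  by apply: acts_exists => x _; apply/lidealP; rewrite -mulgA ug.
by exists m; symmetry; exact: cone_star_principal.
Qed.

Lemma eta_acts e c (x : {k | Hset HL (rho_cone e) c k}) u f
    (uf : Lstar u (sval f)) :
  sval x = principal_cone uf -> sval e * u = u -> acts (eta x) u.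
Proof.
move=> xu eu; have [w xw] := hom_acts (eta x).
have {}xw : acts (eta x) (sval e * w).
  by apply: acts_shift xw _; rewrite mulgA idemE.
have ew : sval e * (sval e * w) = sval e * w by rewrite mulgA idemE.
have [l wl] := Lstar_idem_exists abS (sval e * w).
have := etaP x; rewrite xu (cone_star_principal wl xw ew).
by move=> /principal_cone_inj /(_ e); rewrite eu ew => ->.
Qed.

(** In terms of elements, the transformation induced by [v] sends [rho^u] to
    [rho^(v u)]. *)
Lemma dual_hom_principal e f (m : hom (Lobj f) (Lobj e)) v c
    (x : {k | Hset HL (rho_cone e) c k}) u g (ug : Lstar u (sval g)) l
    (vul : Lstar (v * u) (sval l)) :
  acts m v -> sval f * v = v -> sval x = principal_cone ug -> sval e * u = u ->
  sval ((dual_hom HL (e := rho_cone e) (e' := rho_cone f) m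
     : nat_trans (Hfunctor HL (rho_cone e)) (Hfunctor HL (rho_cone f))) c x) =
  principal_cone vul.
Proof.
move=> mv fv xu eu; apply: cone_star_principal; last by rewrite mulgA fv.
by apply: acts_comp => //; exact: eta_acts xu eu.
Qed.

Lemma dual_hom_incl e f (m : hom (Lobj f) (Lobj e)) :
  acts m (sval e) -> sval f * sval e = sval e ->
  incl (dual_hom HL (e := rho_cone e) (e' := rho_cone f) m).
Proof.
move=> me fe c x.
have [u [g [ug [eu _ xu]]]] := (Hset_principal _ _ _).1 (svalP x).
have eug : Lstar (sval e * u) (sval g) by rewrite eu.
rewrite (dual_hom_principal eug me fe xu eu) xu.
exact: principal_cone_eq.
Qed.

(** Left multiplication by [e] or [f] fixes every element of [e S = f S], so the
    transformations that they induce are inclusions, in both directions. *)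
Lemma dualH_R e f : sval e * sval f = sval f -> sval f * sval e = sval e ->
  dualH HL (rho_cone e) = dualH HL (rho_cone f).
Proof.
move=> ef fe.
have H g h : exists m : hom (Lobj g) (Lobj h), acts m (sval h).
  by apply: acts_exists => x _; apply/lidealP; rewrite -mulgA idemE.
have [m me] := H f e; have [n nf] := H e f.
exact: (dual_incl_antisym (dual_hom_incl me fe) (dual_hom_incl nf ef)).
Qed.

(** The cone [rho^e] belongs to H(rho^e; S e), so it equals [rho^u] for some [u] in
    [f S]. Both [e] and [u] lie in [g S], where [rho^u] determines [u]. *)
Lemma dualH_R_inv g e f : sval g * sval e = sval e -> sval g * sval f = sval f ->
  dualH HL (rho_cone e) = dualH HL (rho_cone f) -> sval f * sval e = sval e.
Proof.
move=> ge gf ef.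
have : Hset HL (rho_cone e) (Lobj e) (rho_cone e).
  apply/Hset_principal; exists (sval e), e, (Lstar_refl (sval e)); split=> //.
    exact: idemE.
  exact: svalP (at_idem e).
have -> : Hset HL (rho_cone e) (Lobj e) = Hset HL (rho_cone f) (Lobj e).
  exact: (congr1 (fun X : dual HL => fobj (sval X) (Lobj e)) ef).
move=> /Hset_principal [u [k [uk [fu _ /principal_cone_inj /(_ g)]]]].
by rewrite ge -fu mulgA gf => ->; rewrite mulgA idemE.
Qed.

(** If [rho^u] is an idempotent cone with apex [S f] then [f u = f], which makes
    [u] idempotent. *)
Lemma idem_cone_rho (E : idem_cone (L S)) e : Hset HL (rho_cone e) (apex E) E ->
  exists2 v, E = rho_cone v & sval e * sval v = sval v.
Proof.
move=> /Hset_principal [u [f [uf [eu _ Eu]]]].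
have uu : u * u = u.
  case: E Eu => k kc ki /= E; subst k; rewrite /= in ki.
  have := congr1 (fun m : hom (Lobj f) (Lobj f) => ap m (at_idem f)) ki.
  rewrite [LHS]/= => fu.
  have {}fu : sval f * u = sval f by [].
  by rewrite -{1}(Lstar_fix uf) -mulgA fu Lstar_fix.
exists (to_idem uu) => //; apply: idem_cone_ext; rewrite Eu.
exact: principal_cone_eq.
Qed.

End DualOfL.

(** * The functor of an anti-isomorphism *)

Section AntiIso.
Variables (S S' : semigroupType) (o : S -> S') (o' : S' -> S).
Hypotheses (oK : cancel o o') (o'K : cancel o' o).
Hypothesis oM : forall x y, o (x * y) = o y * o x.
Hypothesis abS : abundant S.
Variable HL : consistent_category (L S).
Implicit Types (e f g : idem S) (A B D : L S').

Lemma o'M x y : o' (x * y) = o' y * o' x.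
Proof. by rewrite -[RHS]oK oM !o'K. Qed.

Lemma anti_idem_subproof e : o (sval e) * o (sval e) = o (sval e).
Proof. by rewrite -oM idemE. Qed.

Definition anti_idem e : idem S' := to_idem (anti_idem_subproof e).

Definition robj e : L S' := Lobj (anti_idem e).

Lemma robj_exists A : exists e, A = robj e.
Proof.
have [k ->] := LobjP A.
have kk : o' (sval k) * o' (sval k) = o' (sval k) by rewrite -o'M idemE.
by exists (to_idem kk); congr Lobj; apply: sval_inj; rewrite /= o'K.
Qed.

(** An object of [L S'] corresponds under the anti-isomorphism to a right ideal
    [e S]; this is a chosen [e]. By [dualH_R] the choice does not affect the
    functor H(rho^e; -). *)
Definition right_idem A : idem S := sval (cid (robj_exists A)).

Lemma right_idemP A : A = robj (right_idem A).
Proof. exact: svalP (cid (robj_exists A)). Qed.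

Lemma robj_sub e f : sval (robj e) `<=` sval (robj f) <-> sval f * sval e = sval e.
Proof.
apply: (iff_trans (Lobj_sub _ _)) => /=; rewrite -oM.
by split=> [/(can_inj oK)|->].
Qed.

Lemma robj_eq e f : robj e = robj f <->
  sval f * sval e = sval e /\ sval e * sval f = sval f.
Proof.
split=> [ef|[fe ef]]; first by split; apply/robj_sub; rewrite ef.
by apply: sval_inj; apply/seteqP; split; apply/robj_sub.
Qed.

Lemma right_idem_sub A B : sval A `<=` sval B ->
  sval (right_idem B) * sval (right_idem A) = sval (right_idem A).
Proof. by move=> AB; apply/robj_sub; rewrite -!right_idemP. Qed.

Lemma right_idem_mem A : sval A (o (sval (right_idem A))).
Proof. by rewrite [in sval A](right_idemP A); exact: svalP (at_idem (anti_idem _)). Qed.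

(** The element [u] of [f S e] such that the morphism corresponds to
    [x |-> u x] from [e S] to [f S]. *)
Definition coef A B (m : hom A B) : S :=
  o' (ap m (exist _ _ (right_idem_mem A))).

Lemma mul_right_idem A (x : {x | sval A x}) : sval x * o (sval (right_idem A)) = sval x.
Proof. by case: x => x; rewrite /= {1}(right_idemP A) => /lidealP. Qed.

Lemma coefE A B (m : hom A B) w : acts m (o w) -> coef m = w * sval (right_idem A).
Proof. by move=> mw; rewrite /coef mw /= -oM oK. Qed.

Lemma coef_exists A B (m : hom A B) : exists w, acts m (o w).
Proof. by have [w mw] := hom_acts m; exists (o' w); rewrite o'K. Qed.

Lemma coef_acts A B (m : hom A B) : acts m (o (coef m)).
Proof.
have [w mw] := coef_exists m.
by move=> x; rewrite (coefE mw) oM mulgA mul_right_idem mw.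
Qed.

Lemma coef_corner A B (m : hom A B) : corner (right_idem B) (coef m) (right_idem A).
Proof.
have [w mw] := coef_exists m.
apply/cornerP; split; last by rewrite (coefE mw) -mulgA idemE.
by rewrite -[coef m]oK -[sval (right_idem B)]oK -o'M /coef o'K /ap mul_right_idem.
Qed.

Definition Gamma_obj A : dual HL := dualH HL (rho_cone (right_idem A)).

Definition Gamma_mor A B (m : hom A B) : hom (Gamma_obj A) (Gamma_obj B) :=
  dual_hom HL (e := rho_cone (right_idem A)) (e' := rho_cone (right_idem B))
    (rho (coef_corner m)).

Lemma Gamma_mor1 A : Gamma_mor (idm A) = idm (Gamma_obj A).
Proof.
rewrite -dual_hom1 /Gamma_mor; congr dual_hom.
apply: acts_eq (@acts_idm _ (right_idem A)).
suff <- : coef (idm A) = sval (right_idem A) by exact: acts_rho.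
by rewrite /coef /= oK.
Qed.

Lemma Gamma_morM A B D (m : hom A B) (n : hom B D) :
  Gamma_mor (m ;; n) = Gamma_mor m ;; Gamma_mor n.
Proof.
rewrite -dual_homM /Gamma_mor; congr dual_hom.
apply: acts_eq (acts_comp (acts_rho _) (acts_rho _)).
suff <- : coef (m ;; n) = coef n * coef m by exact: acts_rho.
have /coefE -> : acts (m ;; n) (o (coef n * coef m)).
  by rewrite oM; apply: acts_comp; exact: coef_acts.
by rewrite -mulgA; have [_ ->] := (cornerP _ _ _).1 (coef_corner m).
Qed.

Definition Gamma : functor (L S') (dual HL) := Functor Gamma_mor1 Gamma_morM.

Lemma Gamma_robj e : Gamma (robj e) = dualH HL (rho_cone e).
Proof. by have /robj_eq [] := right_idemP (robj e) => ee' e'e; apply: dualH_R. Qed.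

(** Choices are compared on elements: both transformations send [rho^w] to
    [rho^(u w)], because replacing [e] by an [R]-related idempotent does not move
    the elements [w] of [e S]. *)
Lemma Gamma_rho e f u (Hu : corner f u e)
    (Hu' : corner (anti_idem e) (o u) (anti_idem f)) :
  arrow (fmap Gamma (rho Hu')) =
  arrow (dual_hom HL (e := rho_cone e) (e' := rho_cone f) (rho Hu)).
Proof.
apply: dual_arrow; [exact: Gamma_robj|exact: Gamma_robj|] => c x x' xx'.
have [w [l [wl [ew _ xw]]]] := (Hset_principal abS _ _ _ _).1 (svalP x).
have /robj_eq [e1 e2] := right_idemP (robj e).
have ew' : sval e * w = w by rewrite -ew mulgA e2.
have uw : coef (rho Hu') * w = u * w.
  by rewrite (coefE (acts_rho Hu')) -mulgA ew.
have [k uk] := Lstar_idem_exists abS (u * w).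
have uk' : Lstar (coef (rho Hu') * w) (sval k) by rewrite uw.
have [fu _] := (cornerP _ _ _).1 Hu.
have [gu _] := (cornerP _ _ _).1 (coef_corner (rho Hu')).
have xw' : sval x' = principal_cone wl by rewrite -xx'.
rewrite (dual_hom_principal abS uk (acts_rho Hu) fu xw' ew').
rewrite (dual_hom_principal abS uk' (acts_rho (coef_corner (rho Hu'))) gu xw ew).
exact: principal_cone_eq.
Qed.

Lemma Gamma_incl : incl_preserving Gamma.
Proof.
move=> A B j ij.
have E : coef j = sval (right_idem A) by rewrite /coef [ap _ _]ij /= oK.
apply: dual_hom_incl => //; first by rewrite -[X in acts _ X]E; exact: acts_rho.
by rewrite -E; have [] := (cornerP _ _ _).1 (coef_corner j).
Qed.

(** Both sides are [f S e]: it gives the maps [e S -> f S] by left translation, and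
    the maps [S f -> S e] by right translation, which are the transformations
    by the Yoneda lemma. *)
Lemma Gamma_fully_faithful : fully_faithful Gamma.
Proof.
move=> A B; apply: inj_surj_bijective => [m n /dual_hom_inj mn|t].
  apply: acts_eq (coef_acts m) _.
  have -> : coef m = coef n.
    have nm : acts (rho (coef_corner m)) (coef n) by rewrite mn; exact: acts_rho.
    have := acts_inj (acts_rho (coef_corner m)) nm.
    by have /cornerP [-> _] := coef_corner m; have /cornerP [-> _] := coef_corner n.
  exact: coef_acts.
have [k kt] := dual_hom_surj t.
have [u [/cornerP [bu ua] ku]] :=
  acts_corner (k : hom (Lobj (right_idem B)) (Lobj (right_idem A))).
have [m mu] : exists m : hom A B, acts m (o u).
  apply: acts_exists => x _; rewrite (right_idemP B); apply/lidealP.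
  by rewrite -mulgA /= -oM bu.
exists m; rewrite -kt; congr dual_hom; apply: acts_eq ku.
by rewrite -ua -(coefE mu); exact: acts_rho.
Qed.

(** A subobject of H(rho^f; -) is H(E; -) for an idempotent cone [E] that belongs
    to H(rho^f; c_E), hence [E = rho^v] for an idempotent [v] in [f S]: the
    subobject is the value at [v S]. Two subobjects of [f S] with the same value
    are equal by [dualH_R_inv]. *)
Lemma Gamma_local_iso : local_iso Gamma.
Proof.
exists Gamma_incl; split; first exact: Gamma_fully_faithful.
move=> D; split; last by move=> A B; exact: Gamma_fully_faithful.
apply: inj_surj_bijective => [A B|X].
  move=> /(congr1 sval) /= AB; apply: sval_inj.
  have [/subobjP Ac /subobjP Bc] := (svalP A, svalP B).
  have ca := right_idem_sub Ac; have cb := right_idem_sub Bc.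
  rewrite (right_idemP (sval A)) (right_idemP (sval B)); apply/robj_eq; split.
    exact: dualH_R_inv ca cb AB.
  exact: dualH_R_inv cb ca (esym AB).
have [E EX] : exists E, sval X = dualH HL E.
  by have [E XE] := svalP (sval X); exists E; apply: sval_inj.
have [t ti] := svalP X; move: t ti; rewrite EX => t ti.
have /(idem_cone_rho abS) [v Ev cv] : Hset HL (rho_cone (right_idem D)) (apex E) E.
  have := ti (apex E) (exist _ _ (idem_cone_Hset HL E)).
  by rewrite [RHS]/= => {2}<-; exact: svalP.
have vD : subobj (robj v) D.
  by rewrite (right_idemP D); apply/subobjP/robj_sub.
exists (exist _ (robj v) vD); apply: sval_inj; rewrite EX Ev.
exact: Gamma_robj.
Qed.

(** If H(rho^e; -) = H(E; -) then [E = rho^u] with [u R e]. Its component at [S g]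
    is an isomorphism exactly when [g u] has an inverse [v], and then [v] is an
    idempotent with [v R e] and [v L g]. The resulting condition no longer
    distinguishes left from right. *)
Lemma Mset_Gamma A c : Mset (Gamma A) c <-> exists v, A = robj v /\ c = Lobj v.
Proof.
split=> [[E [AE]]|[v [-> ->]]]; last first.
  exists (rho_cone v); split; first exact: Gamma_robj.
  have -> : leg (rho_cone v) (Lobj v) = idm (Lobj v) by exact: principal_id.
  by exists (idm _); rewrite comp1m.
have /(idem_cone_rho abS) [u Eu au] : Hset HL (rho_cone (right_idem A)) (apex E) E.
  have -> : Hset HL (rho_cone (right_idem A)) (apex E) = Hset HL E (apex E).
    exact: (congr1 (fun X : dual HL => fobj (sval X) (apex E)) AE).
  exact: idem_cone_Hset.
subst E; have ua : sval u * sval (right_idem A) = sval (right_idem A).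
  by apply: (dualH_R_inv abS (idemE _) au AE).
have [g ->] := LobjP c; case=> n [ln nl].
have [v [/cornerP [uv vg] nv]] := acts_corner n.
have lu : acts (leg (rho_cone u) (Lobj g)) (sval u) by [].
have gv : sval g * v = sval g.
  have uv1 : acts (idm (Lobj g)) (sval u * v) by rewrite -ln; exact: acts_comp.
  by have := acts_inj uv1 (@acts_idm _ g); rewrite uv idemE.
have vu : v * sval u = sval u.
  have vu1 : acts (idm (Lobj u)) (v * sval u).
    by rewrite -[idm _]nl; exact: acts_comp nv lu.
  by have := acts_inj vu1 (@acts_idm _ u); rewrite mulgA uv idemE.
have vv : v * v = v by rewrite -{1}vg -mulgA gv vg.
exists (to_idem vv); split.
  rewrite [LHS]right_idemP; apply/robj_eq => /=; split.
    by rewrite -ua mulgA vu.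
  by rewrite -uv mulgA au.
exact/Lobj_eqP.
Qed.

End AntiIso.

(** * The cross-connection of S *)

Theorem theorem4p6 (S : semigroupType) (hS : concordant S) :
  exists (HL : consistent_category (L S)) (HR : consistent_category (R S))
         (Gam : functor (R S) (dual HL)) (Del : functor (L S) (dual HR)),
    [/\ is_Gamma Gam, is_Delta Del & cross_connection Gam Del].
Proof.
pose HL : consistent_category (L S) := L_consistent hS.
have hS' := concordant_opp hS.
pose HR : consistent_category (R S) := L_consistent hS'.
pose o : S -> S^opp := id; pose o' : S^opp -> S := id.
have oK : cancel o o' by []. have o'K : cancel o' o by [].
have oM x y : o (x * y) = o y * o x by [].
have o'M x y : o' (x * y) = o' y * o' x by [].
have [abS _ _] := hS; have [abS' _ _] := hS'.
pose Gam := Gamma oK o'K oM HL; pose Del := Gamma o'K oK o'M HR.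
have opp1 e : anti_idem oM e = idem_opp e by exact: sval_inj.
have opp2 (e : idem S) : anti_idem o'M (idem_opp e) = e by exact: sval_inj.
exists HL, HR, Gam, Del; split.
- split=> [e|e f u Hu].
    by have := Gamma_robj oK o'K oM abS HL e; rewrite /robj opp1.
  have := Gamma_rho oK o'K (oM := oM) abS HL Hu.
  by rewrite !opp1 => /(_ (corner_opp Hu)); exact.
- split=> [e|e f u Hu].
    by have := Gamma_robj o'K oK o'M abS' HR (idem_opp e); rewrite /robj opp2.
  have := Gamma_rho o'K oK (oM := o'M) abS' HR (corner_opp Hu).
  by rewrite !opp2 => /(_ Hu).
- split; [exact: Gamma_local_iso|exact: Gamma_local_iso|] => c d.
  apply: (iff_trans (Mset_Gamma oK o'K oM abS HL d c)).
  apply: iff_sym; apply: (iff_trans (Mset_Gamma o'K oK o'M abS' HR c d)).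
  split=> -[v [-> ->]].
    by exists (anti_idem o'M v); split=> //; congr Lobj; exact: sval_inj.
  by exists (idem_opp v); rewrite /robj opp1 opp2.
Qed.
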